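(* For each $p\ge1$ let $(V^*_p,\mathcal P^*_p)$ be an $\mathbb L$-valued random variable with $0<\mathbb E(|\mathcal P^*_p|)\le1$ and $\lim_{p\to\infty}\mathbb E(|\mathcal P^*_p|)=1$, and let $\mathbb P_p$ be the probability on $\Omega$ under which $(\omega_n,n\in\mathbb Z)$ is i.i.d. with common distribution that of $(V^*_p,\mathcal P^*_p)$. Let $\varepsilon_p>0$ with $\varepsilon_p\to0$ and put $\mathcal H_p(t)=\varepsilon_p\mathcal H([pt])$, $\mathbb H_p(t)=\varepsilon_p\mathbb H([pt])$, $t\ge0$. Assume that: (i) for every $p\ge1$, $\mathbb E(\mathbb Y^*_p)<\infty$, and there exists an integrable random variable $\bar{\mathbb Y}$ with $\mathbb E\bar{\mathbb Y}=0$ such that, as $p\to\infty$, $\mathbb Y^*_p-\mathbb E(\mathbb Y^*_p)$ converges in distribution to $\bar{\mathbb Y}$ and $\mathbb E[(\mathbb Y^*_p-\mathbb E(\mathbb Y^*_p))^+]\to\mathbb E(\bar{\mathbb Y}^+)$; (ii) $p\varepsilon_p\to\infty$; (iii) $\mathbb E(\mathbb Y^*_p)\to\alpha^*$ for some $\alpha^*\in(0,\infty)$; (iv) $\mathcal H_p\Rightarrow\mathcal H_\infty$ for some process $\mathcal H_\infty$ satisfying $\mathbb P(\mathcal H_\infty(t)>0)=1$ for every $t>0$. Then $(\mathcal H_p,\mathbb H_p)$ under $\mathbb P_p$ converges in the sense of finite-dimensional distributions to $(\mathcal H_\infty,\alpha^*\mathcal H_\infty)$ as $p\to\infty$.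
   Context: $\mathcal M$ is the set of finite point measures on $(0,\infty)$ (weak topology), $\epsilon_x$ the Dirac mass at $x$, $\mathbf z$ the zero measure. For $\nu\in\mathcal M$, $|\nu|=\nu(0,\infty)$, $\pi(\nu)$ is the supremum of its support ($\pi(\mathbf z)=0$), and $\Upsilon_k(\nu)$ is obtained from $\nu$ by removing its $k$ largest atoms, counted with multiplicity ($\Upsilon_k(\nu)=\mathbf z$ if $k\ge|\nu|$). $\mathcal M^*=\bigcup_{n\ge0}(\mathcal M\setminus\{\mathbf z\})^n$; the empty sequence is identified with $\mathbf z$; $[\cdot,\cdot]$ is concatenation ($\mathbf z$ neutral); $\pi(Y)=\sum_{k=1}^{\mathrm{Len}(Y)}\pi(Y(k))$ for $Y\in\mathcal M^*$ of length $\mathrm{Len}(Y)$. $\mathbb L=\{(v,\nu)\in(0,\infty)\times\mathcal M:v\ge\pi(\nu)\}$, $\Omega=\mathbb L^{\mathbb Z}$, $\omega=(\omega_n)_{n\in\mathbb Z}$ with $\omega_n=(V_n,\mathcal P_n)$; $\mathcal G(\omega)=((1,|\mathcal P_n|\epsilon_1),n\in\mathbb Z)$. $[x]$ is the integer part, $x^+=\max(x,0)$. For $Y\in\mathcal M^*$, $\nu\in\mathcal M$, put $H=\max\{k\ge1:|Y(k)|\ge2\}$ ($\max\emptyset=-\infty$) and $\Phi(Y,\nu)=[Y,\nu]$ if $\nu\ne\mathbf z$; $\Phi(Y,\nu)=(Y(1),\dots,Y(H-1),\Upsilon_1(Y(H)))$ if $\nu=\mathbf z$ and $H\ge1$; $\Phi(Y,\nu)=\mathbf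 z$ otherwise. The spine process is $\mathbb S^0_0=\mathbf z$, $\mathbb S^{n+1}_0=\Phi(\mathbb S^n_0,\mathcal P_n)$. The chronological height process is $\mathbb H(n)=\pi(\mathbb S^n_0)$, $n\ge 0$, and the genealogical height process is $\mathcal H=\mathbb H\circ\mathcal G$. $\mathbb Y^*_p$ is the random variable with law given by $$\mathbb E[f(\mathbb Y^*_p)]=\sum_{k=1}^\infty\sum_{r=0}^{k-1}\frac1k\,\mathbb E\left[f\circ\pi\circ\Upsilon_r(\mathcal P^*_p)\ \middle|\ |\mathcal P^*_p|=k\right]\times\frac{k\,\mathbb P(|\mathcal P^*_p|=k)}{\mathbb E(|\mathcal P^*_p|)}$$ for bounded measurable $f$. $\Rightarrow$ denotes weak convergence under $\mathbb P_p$; for processes this is functional weak convergence (space of càdlàg paths on $[0,\infty)$ with the Skorokhod topology), understood to include convergence of finite-dimensional distributions (which is automatic when the limit is continuous). *)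

(* Defs.v *)
From HB Require Import structures.
From mathcomp Require Import all_boot all_order all_algebra.
From mathcomp Require Import all_classical all_reals all_analysis.
Set Implicit Arguments.
Unset Strict Implicit.
Unset Printing Implicit Defensive.
Import Order.TTheory GRing.Theory Num.Theory.
Import numFieldNormedType.Exports.
Local Open Scope classical_set_scope.
Local Open Scope ring_scope.

(* The finite point measure sum_i \d_(x_i) is represented by its atoms, listed
   in nonincreasing order with multiplicity. *)
Record pmeasure (R : realType) := PMeasure {
  atoms :> seq R ;
  atomsP : sorted >=%R atoms && all (> 0) atoms }.

HB.instance Definition _ (R : realType) := [isSub for @atoms R].
HB.instance Definition _ (R : realType) := [Choice of pmeasure R by <:].

Section PointMeasures.
Context {R : realType}.
Implicit Types (nu : pmeasure R) (k : nat).

Definition mass nu : nat := size nu.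

(* supremum of the support; [sup set0 = 0] *)
Definition psup nu : R := sup [set x | x \in (nu : seq R)].

Lemma removeP k nu : sorted >=%R (drop k nu) && all (> 0) (drop k nu).
Proof.
case/andP: (atomsP nu) => s a; rewrite drop_sorted//=.
by apply/allP => x /mem_drop; exact/allP.
Qed.
Definition remove k nu := PMeasure (removeP k nu).

Lemma dirac1P k : sorted >=%R (nseq k (1 : R)) && all (> 0) (nseq k (1 : R)).
Proof.
apply/andP; split; last by rewrite all_nseq ltr01 orbT.
by case: k => //=; elim=> //= k ->; rewrite lexx.
Qed.
Definition dirac1 k := PMeasure (dirac1P k).

Definition pzero := dirac1 0.

HB.instance Definition _ := isPointed.Build (pmeasure R) pzero.

Definition test_function := {f : R -> R |
  {within `]0, +oo[, continuous f} /\
  exists M, forall x, 0 < x -> `|f x| <= M}.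

Definition pintegral nu (f : test_function) : R := \sum_(x <- nu) sval f x.

End PointMeasures.

(* Weak topology: the coarsest one making [nu |-> \int f dnu] continuous for
   every bounded continuous f on (0, +oo). *)
HB.instance Definition _ (R : realType) :=
  Topological.copy (pmeasure R)
    (sup_topology (fun f : @test_function R => Topological.class
      (initial_topology (fun nu : pmeasure R => pintegral nu f)))).

Definition life (R : realType) : set (R * pmeasure R)%type :=
  [set x | 0 < x.1 /\ psup x.2 <= x.1].
Arguments life R : clear implicits.

Section Life.
Context {R : realType}.

Lemma psup_dirac1 k : psup (dirac1 k : pmeasure R) <= 1.
Proof.
rewrite /psup; have [->|/set0P[x x0]] :=
  eqVneq [set x | x \in (dirac1 k : seq R)] set0; first by rewrite sup0.
by apply: ge_sup => [|y /=]; [exists x|rewrite mem_nseq => /andP[_ /eqP->]].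
Qed.

Lemma life_dirac1 k : (1, dirac1 k) \in life R.
Proof. by rewrite inE; split => /=; [exact: ltr01|exact: psup_dirac1]. Qed.

Definition life_genealogical k : life R := SigSub (life_dirac1 k).

HB.instance Definition _ := isPointed.Build (life R) (life_genealogical 0).

End Life.

(* L = {(v, nu) | v >= pi(nu)} with its Borel sigma-algebra, as a subspace of
   the product of R and the point measures *)
Definition L (R : realType) : measurableType _ :=
  g_sigma_algebraType (@open (life R)).

Definition children {R : realType} (x : L R) : pmeasure R := (sval x).2.

Definition cylinders (R : realType) : set_system (int -> L R) :=
  [set A | exists n : int, exists2 B : set (L R),
     measurable B & A = [set w | B (w n)]].

Definition Omega (R : realType) : measurableType _ :=
  g_sigma_algebraType (@cylinders R).

Definition genealogy {R : realType} (w : Omega R) : Omega R :=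
  fun n => life_genealogical (mass (children (w n))).

Section Spine.
Context {R : realType}.

(* A sequence Y = (Y(1), ..., Y(n)) of nonzero measures is a [seq], with Y(k)
   at index k.-1; [::] plays the role of the zero measure. The value 0 stands
   for the maximum of the empty set. *)
Definition last_multiple (Y : seq (pmeasure R)) : nat :=
  \max_(k < size Y | (2 <= mass (nth pzero Y k))%N) k.+1.

Definition Phi (Y : seq (pmeasure R)) (nu : pmeasure R) : seq (pmeasure R) :=
  let H := last_multiple Y in
  if nu != pzero then rcons Y nu
  else if (1 <= H)%N then rcons (take H.-1 Y) (remove 1 (nth pzero Y H.-1))
  else [::].

Fixpoint spine (w : Omega R) (n : nat) : seq (pmeasure R) :=
  if n is m.+1 then Phi (spine w m) (children (w m%:Z)) else [::].

Definition chronological_height (w : Omega R) (n : nat) : R :=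
  \sum_(nu <- spine w n) psup nu.

Definition genealogical_height (w : Omega R) : nat -> R :=
  chronological_height (genealogy w).

End Spine.

Definition cadlag {R : realType} (x : R -> R) :=
  (forall t, 0 <= t -> x @ t^'+ --> x t) /\
  (forall t, 0 < t -> cvg (x @ t^'-)).

(* Only the values on [0, +oo) matter: the topology below does not separate
   paths that agree there. *)
Record cadlag_path (R : realType) := Path {
  path_fun :> R -> R ;
  path_cadlag : cadlag path_fun }.

HB.instance Definition _ (R : realType) := gen_eqMixin (cadlag_path R).
HB.instance Definition _ (R : realType) := gen_choiceMixin (cadlag_path R).

Section Skorokhod.
Context {R : realType}.
Implicit Types (x y z : cadlag_path R) (l m : R -> R) (N e : R).

(* increasing bijections of [0, +oo); they are automatically continuous *)
Definition time_change l :=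
  [/\ forall t, 0 <= t -> 0 <= l t,
      forall s t, 0 <= s -> s < t -> l s < l t &
      forall u, 0 <= u -> exists2 t, 0 <= t & l t = u].

(* [y_n] converges to [x] in the J1 topology on [0, +oo) iff, for all [N] and
   [e > 0], [y_n] eventually lies in [skorokhod_ball x (N, e)] (see Jacod and
   Shiryaev, Limit Theorems for Stochastic Processes, VI.1.14). *)
Definition skorokhod_ball x (Ne : R * R) : set (cadlag_path R) :=
  [set y | exists l, [/\ time_change l,
     forall t, 0 <= t -> `|l t - t| < Ne.2 &
     forall t, 0 <= t <= Ne.1 -> `|y (l t) - x t| < Ne.2]].

Definition skorokhod_nbhs x : set_system (cadlag_path R) :=
  filter_from [set Ne : R * R | 0 < Ne.2] (skorokhod_ball x).

Lemma skorokhod_ballS x N N' e e' : N' <= N -> e <= e' ->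
  skorokhod_ball x (N, e) `<=` skorokhod_ball x (N', e').
Proof.
move=> NN ee y [l [tl /= le ly]]; exists l; split => //= t t0.
  by rewrite (lt_le_trans (le _ t0)).
case/andP: t0 => t0 tN.
by rewrite (lt_le_trans (ly _ _))// t0 (le_trans tN).
Qed.

Lemma skorokhod_ball_center x Ne : 0 < Ne.2 -> skorokhod_ball x Ne x.
Proof.
move=> e0; exists id; split; last 2 first.
- by move=> t _; rewrite subrr normr0.
- by move=> t _; rewrite subrr normr0.
- by split => // u u0; exists u.
Qed.

Lemma skorokhod_ball_trans x y z N e : 0 < e ->
  skorokhod_ball x (N, e / 2) y -> skorokhod_ball y (N + e, e / 2) z ->
  skorokhod_ball x (N, e) z.
Proof.
move=> e0 [l [[l0 linc lsurj] /= le ly]] [m [[m0 minc msurj] /= me mz]].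
exists (m \o l); split => /=.
- split=> [t t0|s t s0 st|u u0] /=.
  + exact/m0/l0.
  + by apply: minc; [exact: l0|exact: linc].
  + have [v v0 <-] := msurj u u0; have [t t0 <-] := lsurj v v0.
    by exists t.
- move=> t t0; rewrite -(subrKA (l t)) (le_lt_trans (ler_normD _ _))//.
  by rewrite [e]splitr ltrD ?me ?le ?l0.
- move=> t /andP[t0 tN].
  rewrite -(subrKA (y (l t))) (le_lt_trans (ler_normD _ _))//.
  rewrite [e]splitr ltrD ?ly ?t0// mz// l0//=.
  have := le t t0; rewrite ltr_distl => /andP[_ /ltW/le_trans]; apply.
  by rewrite lerD// ler_piMr ?(ltW e0)// invf_le1 ?ler1n.
Qed.

Lemma skorokhod_filter x : ProperFilter (skorokhod_nbhs x).
Proof.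
apply: filter_from_proper; last first.
  by move=> Ne /(skorokhod_ball_center x); exists x.
apply: filter_from_filter; first by exists (0, 1) => /=.
move=> [N e] [N' e'] /= e0 e'0.
exists (Num.max N N', Num.min e e') => /=; first by rewrite lt_min e0.
by move=> y xy; split; apply: skorokhod_ballS xy;
  rewrite ?le_max ?ge_min lexx ?orbT.
Qed.

HB.instance Definition _ := hasNbhs.Build (cadlag_path R) skorokhod_nbhs.

Lemma skorokhod_singleton x (A : set (cadlag_path R)) : nbhs x A -> A x.
Proof. by move=> [Ne /(skorokhod_ball_center x) xx]; apply. Qed.

Lemma skorokhod_nbhs_nbhs x (A : set (cadlag_path R)) :
  nbhs x A -> nbhs x (nbhs^~ A).
Proof.
move=> [[N e] /= e0 sA]; exists (N, e / 2) => /=; first by rewrite divr_gt0.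
move=> y xy; exists (N + e, e / 2) => /=; first by rewrite divr_gt0.
by move=> z yz; apply: sA; exact: skorokhod_ball_trans xy yz.
Qed.

HB.instance Definition _ := Nbhs_isNbhsTopological.Build (cadlag_path R)
  skorokhod_filter skorokhod_singleton skorokhod_nbhs_nbhs.

End Skorokhod.

Section RescaledPath.
Context {R : realType}.

Lemma rescaled_cadlag (e : R) (p : nat) (a : nat -> R) :
  cadlag (fun t => e * a (Num.truncn (p%:R * t))).
Proof.
have [->|p0] := posnP p.
  split => t _; under eq_fun do rewrite mul0r.
    by rewrite mul0r; exact: cvg_cst.
  exact: is_cvg_cst.
have {}p0 : 0 < p%:R :> R by rewrite ltr0n.
split => t t0.
  apply: cvg_near_cst; set k := Num.truncn (p%:R * t).
  have /andP[kt tk] : k%:R <= p%:R * t < k.+1%:R.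
    by apply: truncn_itv; rewrite mulr_ge0 ?(ltW p0).
  near=> s; congr (e * a _); apply/eqP; rewrite truncn_eq; last first.
    by rewrite mulr_ge0 ?(ltW p0)// (le_trans t0).
  rewrite (le_trans kt) ?ler_wpM2l ?(ltW p0)//= mulrC -ltr_pdivlMr//.
  near: s; apply: nbhs_right_lt.
  by rewrite ltr_pdivlMr// mulrC.
set k := (Num.truncn (p%:R * t)); pose m := if k%:R == p%:R * t then k.-1 else k.
have pt0 : 0 < p%:R * t by rewrite mulr_gt0.
have /andP[mt tm] : m%:R < p%:R * t <= m.+1%:R.
  have /andP[kt tk] : k%:R <= p%:R * t < k.+1%:R.
    by apply: truncn_itv; exact: ltW.
  rewrite /m; case: eqP => [ktE|/eqP ktN]; last by rewrite (ltW tk) andbT lt_neqAle ktN kt.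
  have k0 : (0 < k)%N by rewrite -(ltr0n R) ktE.
  by rewrite -ktE prednK// lexx ltr_nat ltn_predL k0.
apply: (cvgP (e * a m)); apply: cvg_near_cst; near=> s.
congr (e * a _); apply/eqP.
have ms : m%:R < p%:R * s.
  rewrite mulrC -ltr_pdivrMr//; near: s; apply: nbhs_left_gt.
  by rewrite ltr_pdivrMr// mulrC.
rewrite truncn_eq ?(ltW ms)/= ?(le_trans _ (ltW ms))//.
by rewrite (lt_le_trans _ tm)// ltr_pM2l.
Unshelve. all: by end_near. Qed.

Definition rescaled_path (e : R) (p : nat) (a : nat -> R) : cadlag_path R :=
  Path (rescaled_cadlag e p a).

End RescaledPath.

Section Probability.
Context {R : realType}.

Definition identically_distributed (P : probability (Omega R) R)
    (mu : probability (L R) R) :=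
  forall (n : int) (B : set (L R)), measurable B ->
    P [set w | B (w n)] = mu B.

Definition independent_coordinates (P : probability (Omega R) R) :=
  forall (s : seq int) (B : int -> set (L R)), uniq s ->
    (forall n, measurable (B n)) ->
    P [set w | forall n, n \in s -> B n (w n)] =
    (\prod_(n <- s) P [set w | B n (w n)])%E.

Definition cvg_in_law (E : topologicalType)
    (d : nat -> measure_display) (T : forall p, measurableType (d p))
    (P : forall p, probability (T p) R) (X : forall p, T p -> E)
    (d' : measure_display) (T' : measurableType d')
    (P' : probability T' R) (X' : T' -> E) :=
  forall f : E -> R, continuous f -> (exists M, forall x, `|f x| <= M) ->
    ('E_(P p)[f \o X p] @[p --> \oo] --> 'E_P'[f \o X'])%E.

Definition fdd_cvg (E : topologicalType)
    (d : nat -> measure_display) (T : forall p, measurableType (d p))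
    (P : forall p, probability (T p) R) (X : forall p, T p -> R -> E)
    (d' : measure_display) (T' : measurableType d')
    (P' : probability T' R) (X' : T' -> R -> E) :=
  forall (n : nat) (t : 'I_n -> R), (forall i, 0 <= t i) ->
    cvg_in_law P
      (fun p w => (fun i => X p w (t i)) : {ptws 'I_n -> E})
      P' (fun w => (fun i => X' w (t i)) : {ptws 'I_n -> E}).

(* E[X | A] = E[X 1_A] / P(A); the value is 0 when P(A) = 0 *)
Definition cond_expectation d (T : measurableType d) (P : probability T R)
    (X : T -> R) (A : set T) : R :=
  (\int[P]_(w in A) X w) / fine (P A).

Definition mean_mass d (T : measurableType d) (P : probability T R)
    (nu : T -> pmeasure R) : \bar R := 'E_P[fun w => (mass (nu w))%:R].

(* With probability proportional to P(|nu| = k), choose a size k and a rank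
   r < k; then Y is distributed as the supremum of the support of nu without
   its r largest atoms, given |nu| = k. *)
Definition has_Ystar_law d (T : measurableType d) (P : probability T R)
    (nu : T -> pmeasure R)
    d' (T' : measurableType d') (P' : probability T' R) (Y : T' -> R) :=
  forall f : R -> R, measurable_fun setT f ->
    (exists M, forall x, `|f x| <= M) ->
    \sum_(1 <= k < n) \sum_(0 <= r < k)
      k%:R^-1 *
      cond_expectation P (fun w => f (psup (remove r (nu w))))
                         [set w | mass (nu w) = k] *
      (k%:R * fine (P [set w | mass (nu w) = k]) / fine (mean_mass P nu))
    @[n --> \oo] --> fine 'E_P'[f \o Y].

End Probability.

(* Main.v *)
Require Import Defs.
From HB Require Import structures.
From mathcomp Require Import all_boot all_order all_algebra.
From mathcomp Require Import all_classical all_reals all_analysis.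
From mathcomp Require Import measurable_realfun ring lra.
Import Order.TTheory GRing.Theory Num.Theory.
Import numFieldNormedType.Exports.
Local Open Scope classical_set_scope.
Local Open Scope ring_scope.

Set Implicit Arguments.
Unset Strict Implicit.
Unset Printing Implicit Defensive.

(** Read the offspring measures backwards in time.  A zero measure removes one
atom from the spine, and a measure that has lost its last atom passes the
removal on to the preceding ones.  So the entries of the spine at time [n] are
found by going through the past while counting the removals still to be made:
a generation with more atoms than that contributes the first atom that
survives, a _mark_, and the count restarts at zero ([spine_marks]).  The
chronological height is the sum of the marks and the genealogical height is
their number, for the very same list, since the position of a mark depends on
the sizes of the generations only ([chronological_heightE],
[genealogical_heightE]).  The theorem is thus a law of large numbers for the
marks, with a random number of terms.

A mark is not the atom of an arbitrary generation: given that [r] removals are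
pending, it is the atom of rank [r].  Reversed in time, the histories between
two marks that leave [r] removals pending are first passages of a skip-free
walk at level [r], so that their probabilities add up to at most one
([sum_first_passage_le1]).  Hence successive marks are dominated by independent
draws from the measure giving weight to every atom of an offspring measure,
which is below the law of [Y] because the mean number of atoms is at most one
([sum_weight_le_Ystar]).  The domination suffices for a maximal inequality by
optional stopping with a nonnegative superharmonic function ([Ex_hits_le]).
Taking a quadratic function of the marks truncated at [t] plus a linear
function of what exceeds [t] bounds, without any asymptotics, the probability
that the chronological height deviates from [E[Y]] times the genealogical
height while the latter is at most [N] ([height_deviation]).  To avoid
integrating over product spaces, all this is done for atoms rounded to
multiples of [eta], whose laws are carried by a countable set.

Convergence of the centred [Y p] in law and of the means of their positive
parts makes the excess over [t] small in mean, uniformly in [p], when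
[t - E[Y p]] is large ([near_tail_le]); convergence of the genealogical heights
makes [eps p] times the genealogical height tight ([fdd_tight]).  With [N] and
the allowed deviation both of order [1 / eps p], the bound then tends to zero
([heights_ratio_cvg]), and replacing [alpha * H] by the chronological height
does not change the limit of the finite-dimensional laws
([fdd_perturbation]). *)

(** * Marks of a list of generations *)

(** [l] lists generations from the most recent one, and [r] removals are pending.
    Exhausting the generation [c] takes [size c] removals, the last of which
    makes [c] disappear and is passed on to the older generations; this is why
    [r.+1 - size c] removals remain, one more than before if [c] is empty. *)
Fixpoint marks (A : Type) (r : nat) (l : seq (seq A)) : seq A :=
  if l is c :: l' then
    if drop r c is x :: _ then x :: marks 0 l'
    else marks (r.+1 - size c) l'
  else [::].

Lemma map_marks (A B : Type) (f : A -> B) (l : seq (seq A)) (r : nat) :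
  marks r (map (map f) l) = map f (marks r l).
Proof.
elim: l r => //= c l IH r; rewrite -map_drop size_map.
by case: (drop r c) => [|x d] /=; rewrite IH.
Qed.

Lemma sum_drop (R : nmodType) (A : Type) (f : A -> R) (c : seq A) (N : nat) :
  (size c <= N)%N ->
  \sum_(r < N) (if drop r c is x :: _ then f x else 0) = \sum_(x <- c) f x.
Proof.
elim: c N => [|x c IH] N; first by rewrite big_nil big1.
case: N => // N; rewrite ltnS => cN.
by rewrite big_ord_recl big_cons -(IH N cN).
Qed.

Fixpoint pending (A : Type) (r : nat) (l : seq (seq A)) : option nat :=
  if l is c :: l' then
    if (r < size c)%N then None else pending (r.+1 - size c) l'
  else Some r.

(** The walk from [r] with steps [size c - 1] reaches zero for the first time
    when [l] is exhausted. *)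
Fixpoint first_passage (A : Type) (l : seq (seq A)) (r : nat) : bool :=
  match l, r with
  | [::], _ => r == 0
  | c :: l', r'.+1 => first_passage l' (r' + size c)
  | _ :: _, 0 => false
  end.

Lemma pending_rcons (A : Type) (l : seq (seq A)) (c : seq A) (r : nat) :
  pending r (rcons l c) =
  if pending r l is Some r' then
    if (r' < size c)%N then None else Some (r'.+1 - size c)%N
  else None.
Proof. by elim: l r => //= a l IH r; case: ifP. Qed.

(** The pending removals form a walk with steps [1 - size c] that stays positive
    after time zero; seen from its endpoint [r] and reversed in time, it goes
    down to zero and gets there only at its last step. *)
Lemma pending_rev (A : Type) (l : seq (seq A)) (r : nat) :
  (pending 0 (rev l) == Some r) = first_passage l r.
Proof.
elim: l r => [|c l IH] r /=; first by rewrite [RHS]eq_sym.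
rewrite rev_cons pending_rcons.
case: r => [|r] /=; last rewrite -IH.
  case: (pending 0 (rev l)) => // r'.
  by case: ltnP => // h; rewrite subSn.
case: (pending 0 (rev l)) => // r'; case: ltnP => h.
  apply/esym/negbTE/eqP => -[e]; move: h; rewrite e ltnNge leq_addl//.
by rewrite subSn//; apply/eqP/eqP => -[]; [move=> <-|move=> ->]; rewrite ?subnK ?addnK.
Qed.

Section WeightedLists.
Context {R : realType} {A : eqType}.
Variables (cs : seq (seq A)) (q : seq A -> R).
Hypotheses (q0 : forall c, 0 <= q c) (q1 : \sum_(c <- cs) q c <= 1).

(** Expectation over [n] independent draws from the weights [q], whose total mass
    may be less than one. *)
Fixpoint Ex (n : nat) (F : seq (seq A) -> R) : R :=
  if n is m.+1 then \sum_(c <- cs) q c * Ex m (fun l => F (c :: l))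
  else F [::].

Lemma ler_Ex n (F G : seq (seq A) -> R) :
  (forall l, size l = n -> F l <= G l) -> Ex n F <= Ex n G.
Proof.
elim: n F G => [|n IH] F G FG /=; first exact: FG.
apply: ler_sum => c _; apply: ler_wpM2l => //.
by apply: IH => l sl; apply: FG; rewrite /= sl.
Qed.

Lemma eq_Ex n (F G : seq (seq A) -> R) : F =1 G -> Ex n F = Ex n G.
Proof. by move=> FG; apply/le_anti/andP; split; apply: ler_Ex => l _; rewrite FG. Qed.

Lemma Ex0 n : Ex n (fun=> 0) = 0.
Proof. by elim: n => //= n ->; rewrite big1// => c _; rewrite mulr0. Qed.

Lemma Ex_sum n (I : Type) (s : seq I) (a : I -> R) (F : I -> seq (seq A) -> R) :
  Ex n (fun l => \sum_(i <- s) a i * F i l) = \sum_(i <- s) a i * Ex n (F i).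
Proof.
elim: n F => //= n IH F.
under eq_bigr do rewrite IH mulr_sumr.
rewrite exchange_big; apply: eq_bigr => i _ /=; rewrite mulr_sumr.
by apply: eq_bigr => c _; rewrite mulrCA.
Qed.

Lemma Ex_rcons n F :
  Ex n.+1 F = \sum_(c <- cs) q c * Ex n (fun l => F (rcons l c)).
Proof.
elim: n F => // n IH F.
rewrite -[LHS]/(\sum_(c <- cs) q c * Ex n.+1 (fun l => F (c :: l))).
under eq_bigr do rewrite IH mulr_sumr.
rewrite exchange_big; apply: eq_bigr => c _ /=; rewrite mulr_sumr.
by apply: eq_bigr => d _; rewrite mulrCA.
Qed.

Lemma Ex_rev n F : Ex n (F \o rev) = Ex n F.
Proof.
elim: n F => // n IH F; rewrite Ex_rcons /=; apply: eq_bigr => c _.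
by rewrite -[in RHS]IH; congr (_ * _); apply: eq_Ex => l /=; rewrite rev_rcons.
Qed.

(** First passages at distinct times are exclusive. *)
Lemma sum_first_passage_le1 n r :
  \sum_(j < n) Ex j (fun l => (first_passage l r)%:R) <= 1.
Proof.
elim: n r => [|n IH] r; first by rewrite big_ord0 ler01.
rewrite big_ord_recl /=; case: r => [|r].
  rewrite big1 ?addr0// => i _.
  by rewrite big1// => c _; rewrite Ex0 mulr0.
rewrite add0r exchange_big/= (le_trans _ q1)//.
by apply: ler_sum => c _; rewrite -mulr_sumr ler_piMr.
Qed.

Lemma Ex1_le1 n : Ex n (fun=> 1) <= 1.
Proof.
elim: n => //= n IH; apply: le_trans q1; apply: ler_sum => c _.
by rewrite ler_piMr.
Qed.

Section Potential.
Context {S : Type}.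
Variables (step : S -> A -> S) (bad : pred S) (u : S -> R).
Hypotheses (u0 : forall s, 0 <= u s) (ubad : forall s, bad s -> 1 <= u s).

Definition hits (s : S) (xs : seq A) := has bad (s :: scanl step s xs).

(* mean of [u] after a mark read with [r] removals pending *)
Let gamma s r := \sum_(c <- cs) q c * (if drop r c is x :: _ then u (step s x) else 0).

Let gamma_ge0 s r : 0 <= gamma s r.
Proof.
by apply: sumr_ge0 => c _; rewrite mulr_ge0//; case: drop.
Qed.

(* decomposition according to the number [j] of generations before the first
   mark; [bad] is reached after it with probability at most [u] *)
Let hits_le n s r : ~~ bad s ->
  (forall m x, (m < n)%N ->
     Ex m (fun l => (hits (step s x) (marks 0 l))%:R) <= u (step s x)) ->
  Ex n (fun l => (hits s (marks r l))%:R) <=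
  \sum_(j < n) Ex j (fun l => if pending r l is Some r' then gamma s r' else 0).
Proof.
move=> bs; elim: n r => [|n IH] r Hu.
  by rewrite big_ord0 /= /hits /= orbF (negbTE bs).
rewrite big_ord_recl /= exchange_big/= -big_split/= ler_sum// => c _.
rewrite -mulr_sumr -mulrDr ler_wpM2l//.
case: (drop r c) (size_drop r c) => [/esym/eqP|y d /= yd].
  rewrite subn_eq0 leqNgt => /negbTE rc; rewrite add0r rc.
  by apply: IH => m x mn; apply: Hu; exact: ltnW.
rewrite -subn_gt0 -yd /= -[leLHS]addr0; apply: lerD.
  apply: le_trans (Hu _ y (ltnSn n)); apply: ler_Ex => l _.
  by rewrite /hits /= (negbTE bs).
by apply: sumr_ge0 => j _; rewrite Ex0.
Qed.

(* [gamma s r] is weighted by the probability that [r] removals are pending after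
   [j] generations, and summation over [j] costs nothing for each [r] *)
Let sum_gamma_le n s : ~~ bad s ->
  \sum_(j < n) Ex j (fun l => if pending 0 l is Some r then gamma s r else 0) <=
  \sum_(c <- cs) q c * \sum_(x <- c) u (step s x).
Proof.
move=> bs; pose N := \max_(c <- cs) size c.
have sN c : c \in cs -> (size c <= N)%N.
  by move=> cs_c; rewrite /N; exact: leq_bigmax_seq.
have gN r : (N <= r)%N -> gamma s r = 0.
  move=> Nr; rewrite /gamma big_seq big1// => c /sN cN.
  by rewrite drop_oversize ?mulr0// (leq_trans cN).
have E j : Ex j (fun l => if pending 0 l is Some r then gamma s r else 0) =
    \sum_(r < N) gamma s r * Ex j (fun l => (first_passage l r)%:R).
  rewrite -Ex_rev -Ex_sum; apply: eq_Ex => l /=.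
  under eq_bigr do rewrite -pending_rev.
  case: pending => [r|]; last by rewrite big1// => r _; rewrite mulr0.
  have [Nr|rN] := leqP N r.
    rewrite gN// big1// => i _; rewrite (_ : _ == _ = false) ?mulr0//.
    by apply/eqP => -[ri]; move: (ltn_ord i); rewrite -ri ltnNge Nr.
  rewrite (bigD1 (Ordinal rN))//= eqxx mulr1 big1 ?addr0// => i /eqP ir.
  rewrite (_ : _ == _ = false) ?mulr0//; apply/eqP => -[ri]; apply: ir.
  exact/val_inj.
under eq_bigr do rewrite E.
rewrite exchange_big /=.
apply: (@le_trans _ _ (\sum_(r < N) gamma s r)).
  apply: ler_sum => r _; rewrite -mulr_sumr ler_piMr//.
  exact: sum_first_passage_le1.
rewrite exchange_big /= big_seq [leRHS]big_seq; apply: ler_sum => c /sN cN.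
by rewrite -mulr_sumr sum_drop.
Qed.

(** Optional stopping for marks, which are neither independent nor distributed as
    arbitrary entries.  Reversing the history since the previous mark turns its
    weight, for a given number [r] of pending removals, into a first passage
    probability; summed over the length of the history it is at most one.  The
    marks are therefore dominated by independent draws from the measure
    [\sum_c q c * \sum_(x <- c) _], for which [u] is superharmonic. *)
Theorem Ex_hits_le n s :
  (forall s, ~~ bad s -> \sum_(c <- cs) q c * \sum_(x <- c) u (step s x) <= u s) ->
  Ex n (fun l => (hits s (marks 0 l))%:R) <= u s.
Proof.
move=> usuper; elim/ltn_ind: n s => n IH s.
have [bs|bs] := boolP (bad s).
  apply: le_trans (ubad bs); rewrite (le_trans _ (Ex1_le1 n))//.
  by apply: ler_Ex => l _; rewrite lern1 leq_b1.
apply: le_trans (usuper s bs); apply: le_trans (sum_gamma_le n bs).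
by apply: hits_le => // m x mn; exact: IH.
Qed.

End Potential.
End WeightedLists.

(** * The spine read backwards in time *)

Section SpineMarks.
Context {R : realType}.
Implicit Types (nu : pmeasure R) (Y : seq (pmeasure R)).

Lemma psup_head nu : psup nu = head 0 nu.
Proof.
rewrite /psup; case: nu => -[|x s] //= H; last first.
  apply/le_anti/andP; split.
    apply: ge_sup; first by exists x; rewrite /= mem_head.
    move=> y /=; rewrite inE => /predU1P[->//|ys].
    case/andP: H => /= H _; have := H.
    by rewrite path_sortedE ?[in X in X -> _]/=; [move=> /andP[/allP/(_ _ ys)]|exact: ge_trans].
  apply: ub_le_sup; last by rewrite /= mem_head.
  exists x => y /=; rewrite inE => /predU1P[->//|ys].
  case/andP: H => /= H _; have := H.
  by rewrite path_sortedE; [move=> /andP[/allP/(_ _ ys)]|exact: ge_trans].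
by rewrite (_ : [set _ | _] = set0) ?sup0//; apply/seteqP; split => y.
Qed.

Lemma psup_ge0 nu : 0 <= psup nu.
Proof.
by rewrite psup_head; case: nu => -[|x s] //= /andP[_ /= /andP[/ltW]].
Qed.

Lemma pmeasure_eq0 nu : (nu == pzero) = (mass nu == 0).
Proof.
apply/eqP/eqP => [->//|/size0nil nu0].
by apply/val_inj.
Qed.

(** A zero measure only removes one atom, and so [iter r pop] makes [r] pending
    removals. *)
Definition pop Y := Phi Y pzero.

Lemma last_multiple_rcons Y nu : last_multiple (rcons Y nu) =
  if (1 < mass nu)%N then (size Y).+1 else last_multiple Y.
Proof.
rewrite /last_multiple size_rcons big_mkcond big_ord_recr /=.
rewrite nth_rcons ltnn eqxx.
have E : \max_(i < size Y)
    (if (1 < mass (nth pzero (rcons Y nu) i))%N then i.+1 else 0) =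
    last_multiple Y.
  rewrite /last_multiple [RHS]big_mkcond; apply: eq_bigr => i _.
  by rewrite nth_rcons ltn_ord.
rewrite E; case: ifP => _; last by rewrite maxn0.
apply/maxn_idPr; rewrite -E; apply/bigmax_leqP => i _.
by case: ifP => // _; rewrite leqW.
Qed.

Lemma last_multiple_le Y : (last_multiple Y <= size Y)%N.
Proof. by apply/bigmax_leqP => i _. Qed.

(** Cutting the spine at its last multiple entry amounts to dropping singletons
    one by one until an atom can be removed without emptying an entry. *)
Lemma pop_rcons Y nu : nu != pzero -> pop (rcons Y nu) =
  if (1 < mass nu)%N then rcons Y (remove 1 nu) else pop Y.
Proof.
rewrite /pop /Phi eqxx /= => nu0; rewrite last_multiple_rcons.
case: (ltnP 1 (mass nu)) => nu1 /=.
  by rewrite -[in take _ _]cats1 takel_cat// take_size nth_rcons ltnn eqxx.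
case: ifP => // H; have HY := last_multiple_le Y.
have HY' : ((last_multiple Y).-1 < size Y)%N by rewrite prednK.
by rewrite -[in take _ _]cats1 takel_cat 1?ltnW// nth_rcons HY'.
Qed.

Lemma mass_remove k nu : mass (remove k nu) = (mass nu - k)%N.
Proof. exact: size_drop. Qed.

Lemma removeD j k nu : remove j (remove k nu) = remove (j + k) nu.
Proof. by apply/val_inj; rewrite /= drop_drop. Qed.

Lemma iter_pop_rcons Y nu r : nu != pzero -> iter r pop (rcons Y nu) =
  if (r < mass nu)%N then rcons Y (remove r nu)
  else iter (r.+1 - mass nu) pop Y.
Proof.
rewrite pmeasure_eq0 -lt0n => nu0; elim: r => [|r IH] /=.
  by rewrite nu0; congr rcons; apply/val_inj; rewrite /= drop0.
rewrite IH; have [rnu|nur] := ltnP r (mass nu).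
  rewrite pop_rcons ?pmeasure_eq0 -?lt0n mass_remove ?subn_gt0//.
  rewrite ltn_subRL addn1 removeD add1n; case: ltnP => // h.
  have -> : mass nu = r.+1 by apply/eqP; rewrite eqn_leq h rnu.
  by rewrite subSnn.
by rewrite ltnNge (leqW nur) /= [(r.+2 - _)%N]subSn ?(leqW nur).
Qed.

Fixpoint past (w : Omega R) (n : nat) : seq (seq R) :=
  if n is m.+1 then (children (w m%:Z) : seq R) :: past w m else [::].

(** Pending removals reach the newest generation first; when that generation is
    empty, [Phi] turns it into one more removal.  The induction on [n] therefore
    needs all values of [r]. *)
Lemma spine_marks_pop (w : Omega R) n r :
  map psup (iter r pop (spine w n)) = rev (marks r (past w n)).
Proof.
elim: n r => [|n IH] r /=.
  suff -> : iter r pop [::] = [::] by [].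
  elim: r => //= r ->; rewrite /pop /Phi eqxx /=.
  by rewrite /last_multiple big_ord0.
set nu := children _.
have [nu0|nu0] := eqVneq nu pzero.
  rewrite nu0 /= subn0 -(IH r.+1) iterSr.
  by rewrite /Phi eqxx; case: (r).
rewrite {1}/Phi nu0 iter_pop_rcons// /mass.
case: ltnP => rnu; last by rewrite drop_oversize// IH.
rewrite map_rcons psup_head /= (drop_nth 0 rnu) /= rev_cons; congr rcons.
exact: (IH 0%N).
Qed.

Lemma spine_marks (w : Omega R) n : map psup (spine w n) = rev (marks 0 (past w n)).
Proof. exact: (spine_marks_pop w n 0). Qed.

Lemma chronological_heightE (w : Omega R) n :
  chronological_height w n = \sum_(x <- marks 0 (past w n)) x.
Proof.
by rewrite /chronological_height -(big_map psup predT id) spine_marks big_rev.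
Qed.

Lemma genealogical_heightE (w : Omega R) n :
  genealogical_height w n = (size (marks 0 (past w n)))%:R.
Proof.
rewrite /genealogical_height chronological_heightE.
have -> : past (genealogy w) n = map (map (fun=> 1)) (past w n).
  elim: n => //= n ->; congr cons; rewrite /children /genealogy /=.
  by rewrite /mass; elim: (atoms _) => //= x s ->.
by rewrite map_marks big_map big_const_seq count_predT iter_addr_0.
Qed.

End SpineMarks.

(** * Measurability of atoms and heights *)

Section Atoms.
Context {R : realType}.

(** A continuous function increasing with [n] to the indicator of [`]a, +oo[]. *)
Definition ramp (a : R) (n : nat) (y : R) : R :=
  Num.min 1 (n.+1%:R * Num.max 0 (y - a)).

Lemma ramp_le1 a n y : ramp a n y <= 1.
Proof. by rewrite /ramp ge_min lexx. Qed.

Lemma ramp_ge0 a n y : 0 <= ramp a n y.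
Proof. by rewrite /ramp le_min ler01/= mulr_ge0// le_max lexx. Qed.

Lemma ramp_eq0 a n y : y <= a -> ramp a n y = 0.
Proof.
move=> ya; rewrite /ramp (max_idPl _) ?subr_le0// mulr0.
by apply/min_idPr; exact: ler01.
Qed.

Lemma continuous_ramp a n : continuous (ramp a n).
Proof.
move=> y.
apply: (@continuous_min R R (cst 1) (fun y => n.+1%:R * Num.max 0 (y - a))).
  exact: cvg_cst.
apply: cvgM; first exact: cvg_cst.
apply: (@continuous_max R R (cst 0) (fun y => y - a)); first exact: cvg_cst.
by apply: cvgB; [exact: cvg_id|exact: cvg_cst].
Qed.

Lemma ramp_test (a : R) (n : nat) :
  {within `]0, +oo[, continuous (ramp a n)} /\
  exists M, forall x, 0 < x -> `|ramp a n x| <= M.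
Proof.
split; first by apply: continuous_subspaceT; exact: continuous_ramp.
by exists 1 => x _; rewrite ger0_norm ?ramp_ge0// ramp_le1.
Qed.

Definition ramp_function (a : R) (n : nat) : test_function :=
  exist _ (ramp a n) (ramp_test a n).

(** The ramps being below the indicator, the integral exceeds [r] only if more
    than [r] atoms are above [a]; conversely the [r.+1] largest atoms, if above
    [a], contribute one each as soon as the ramp is steep enough. *)
Lemma nth_atoms_gtE (nu : pmeasure R) (r : nat) (a : R) : 0 <= a ->
  a < nth 0 nu r <-> exists n, r%:R < pintegral nu (ramp_function a n).
Proof.
case: nu => s Hs a0; have /andP[ss _] := Hs; rewrite /pintegral /=; split.
  move=> ar.
  have rs : (r < size s)%N.
    by rewrite ltnNge; apply/negP => /(nth_default 0) E; move: ar; rewrite E ltNge a0.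
  pose d := nth 0 s r - a; have d0 : 0 < d by rewrite subr_gt0.
  exists (Num.truncn d^-1).
  rewrite -(cat_take_drop r.+1 s) big_cat/= ltr_wpDr//.
    by apply: sumr_ge0 => *; exact: ramp_ge0.
  rewrite (eq_big_seq (fun=> 1)).
    rewrite big_const_seq count_predT iter_addr_0 size_take_min.
    by rewrite (minn_idPl rs) ltr_nat.
  move=> y /(nthP 0)[i]; rewrite size_take_min ltn_min => /andP[ir is_] <-.
  rewrite nth_take// /ramp; apply/min_idPl.
  have dy : d <= nth 0 s i - a.
    rewrite lerD2r.
    by apply: (sorted_leq_nth ge_trans ge_refl 0 ss); rewrite ?inE.
  rewrite (max_idPr _) ?(le_trans (ltW d0))//.
  apply: (@le_trans _ _ (d^-1 * d)); first by rewrite mulVf// gt_eqF.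
  apply: ler_pM => //; first by rewrite invr_ge0 ltW.
    exact: ltW.
  exact/ltW/truncnS_gt.
move=> [n rn]; rewrite ltNge; apply/negP => ra; move: rn.
rewrite ltNge => /negP; apply.
have E : \sum_(y <- drop r s) ramp a n y = 0.
  rewrite big_seq big1// => y /(nthP 0)[i].
  rewrite size_drop ltn_subRL => is_ <-.
  apply: ramp_eq0; rewrite nth_drop (le_trans _ ra)//.
  apply: (sorted_leq_nth ge_trans ge_refl 0 ss); rewrite ?inE ?leq_addr//.
  by apply: leq_ltn_trans is_; exact: leq_addr.
rewrite -(cat_take_drop r s) big_cat/= E addr0.
rewrite (le_trans (ler_sum _ (fun y _ => ramp_le1 a n y)))//.
by rewrite big_const_seq count_predT iter_addr_0 size_take_min ler_nat geq_minl.
Qed.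

Definition atom (r : nat) (x : L R) : R := nth 0 (children x) r.

Lemma pintegral_continuous (f : @test_function R) :
  continuous (fun nu : pmeasure R => pintegral nu f).
Proof.
move=> nu A nA.
have := (@cvg_sup _ _ (fun f : @test_function R => Topological.class
  (initial_topology (fun nu : pmeasure R => pintegral nu f))) (nbhs nu) nu _).1
  (@cvg_id _ _) f.
apply.
exact: (@initial_continuous _ _ (fun nu : pmeasure R => pintegral nu f)).
Qed.


(** Ordered atoms are lower semicontinuous for the weak topology. *)
Lemma open_atom_gt (r : nat) (a : R) : @open (life R) [set x | a < atom r x].
Proof.
have [a0|a0] := ltP a 0.
  rewrite (_ : [set _ | _] = setT); first exact: openT.
  apply/seteqP; split => // x _ /=; rewrite (lt_le_trans a0)// /atom.
  case: (children x) => s /andP[_ s0] /=.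
  have [rs|rs] := ltnP r (size s); last by rewrite nth_default.
  exact/ltW/(allP s0)/mem_nth.
rewrite (_ : [set _ | _] = \bigcup_n ((fun x : life R => pintegral (sval x).2 (ramp_function a n)) @^-1` `]r%:R, +oo[)).
  apply: bigcup_open => n _.
  apply: open_comp; last exact: interval_open.
  move=> x _.
  apply: (@continuous_comp _ _ _ (fun x : life R => (sval x).2)
    (fun nu => pintegral nu (ramp_function a n))); last exact: pintegral_continuous.
  apply: (@continuous_comp _ _ _ (sval : life R -> R * pmeasure R) snd).
    exact: initial_continuous.
  exact: cvg_snd.
apply/seteqP; split => x /=.
  by move/(nth_atoms_gtE _ _ a0) => [n rn]; exists n => //=; rewrite in_itv/= rn.
move=> [n _ /=]; rewrite in_itv/= andbT => rn.
by apply/(nth_atoms_gtE _ _ a0); exists n.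
Qed.

Lemma measurable_atom r : measurable_fun setT (atom r).
Proof.
move=> mD; apply: (measurability _ (RGenOInfty.measurableE R)) => //.
move=> /= _ [_ [a ->] <-]; rewrite setTI; apply: sub_sigma_algebra.
rewrite [X in open X](_ : _ = [set x | a < atom r x]); first exact: open_atom_gt.
by apply/seteqP; split => x /=; rewrite in_itv/= andbT.
Qed.

End Atoms.

(** * Discretized generations and their joint law *)

Section CountableValues.
Context d (T : measurableType d) (C : countType) (X : T -> C).
Hypothesis mX : forall c, measurable [set t | X t = c].

Lemma measurable_countable_preimage (D : set C) : measurable (X @^-1` D).
Proof.
rewrite (_ : X @^-1` D = \bigcup_n
    (if unpickle n is Some c then [set t | X t = c /\ D c] else set0)).
  apply: bigcupT_measurable => n; case: unpickle => [c|]; last exact: measurable0.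
  have [Dc|nDc] := pselect (D c).
    by rewrite (_ : [set _ | _] = [set t | X t = c])//; apply/seteqP; split => t //= [].
  rewrite (_ : [set _ | _] = set0); first exact: measurable0.
  by apply/seteqP; split => t //= [].
apply/seteqP; split => t /=.
  by move=> Dt; exists (pickle (X t)) => //; rewrite pickleK.
by move=> [n _]; case: unpickle => //= c [->].
Qed.

Lemma measurable_fun_countable d' (T' : measurableType d') (g : C -> T') :
  measurable_fun setT (g \o X).
Proof.
by move=> _ B mB; rewrite setTI comp_preimage; exact: measurable_countable_preimage.
Qed.

Lemma probability_mem_seq (R : realType) (P : probability T R) (s : seq C) :
  uniq s -> P [set t | X t \in s] = (\sum_(c <- s) P [set t | X t = c])%E.
Proof.
elim: s => [_|c s IH /= /andP[cs us]].
  rewrite big_nil (_ : [set _ | _] = set0) ?measure0//.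
  by apply/seteqP; split.
rewrite big_cons -IH// -measureU//; last 2 first.
- exact: (measurable_countable_preimage [set c | c \in s]).
- by apply/seteqP; split => t //= [-> ]; rewrite (negbTE cs).
congr (P _); apply/seteqP; split => t /=; rewrite inE.
  by move=> /predU1P.
by move=> ?; exact/predU1P.
Qed.

End CountableValues.

Section Codes.
Context {R : realType}.
Variable eta : R.
Hypothesis eta0 : 0 < eta.

(** [x] is rounded down to [cell x * eta]. *)
Definition cell (x : R) : nat := Num.truncn (x / eta).

Definition code (x : L R) : seq nat := map cell (children x).

Definition past_code (w : Omega R) (n : nat) : seq (seq nat) :=
  map (map cell) (past w n).

Lemma atom_gt0 (x : L R) i : (0 < atom i x) = (i < size (children x))%N.
Proof.
rewrite /atom; case: (children x) => s /= /andP[_ s0].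
have [rs|rs] := ltnP i (size s); last by rewrite nth_default// ltxx.
exact/(allP s0)/mem_nth.
Qed.

Lemma measurable_cell (k : nat) : measurable [set y | 0 < y /\ cell y = k].
Proof.
rewrite (_ : [set _ | _] = `]0, +oo[ `&` `[k%:R * eta, k.+1%:R * eta[).
  by apply: measurableI; exact: measurable_itv.
apply/seteqP; split => y /=; rewrite !in_itv/= andbT.
  move=> [y0 <-]; split => //; rewrite -ler_pdivlMr// -ltr_pdivrMr//.
  by apply: truncn_itv; rewrite divr_ge0 ?ltW.
move=> [y0]; rewrite -ler_pdivlMr// -ltr_pdivrMr// => yk; split => //.
by apply/eqP; rewrite /cell truncn_eq// divr_ge0 ?ltW.
Qed.

Lemma measurable_code (s : seq nat) : measurable [set x : L R | code x = s].
Proof.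
rewrite (_ : [set _ | _] = \bigcap_i (atom i @^-1`
  (if (i < size s)%N then [set y | 0 < y /\ cell y = nth 0%N s i]
   else ~` `]0, +oo[))).
  apply: bigcapT_measurable => i; rewrite -[X in measurable X]setTI.
  apply: measurable_atom => //; case: ifP => _; first exact: measurable_cell.
  by apply: measurableC; exact: measurable_itv.
apply/seteqP; split => x /=.
  move=> <- i _; rewrite /= size_map; case: ifP => [ix|/negbT ix] /=.
    by rewrite atom_gt0 ix (nth_map 0).
  by rewrite in_itv/= andbT atom_gt0; exact/negP.
move=> H.
have E i : (i < size (children x))%N = (i < size s)%N.
  have := H i I; rewrite /= -atom_gt0; case: ifP => _ /=.
    by move=> [->].
  by rewrite in_itv/= andbT => /negP/negbTE.
have sx : size (children x) = size s.
  by apply/eqP; rewrite eqn_leq leqNgt E ltnn leqNgt -E ltnn.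
apply: (@eq_from_nth _ 0%N); first by rewrite size_map.
move=> i; rewrite size_map => ix; rewrite (nth_map 0)//.
by have := H i I; rewrite /= -E ix => -[].
Qed.

Lemma measurable_coordinate (n : int) :
  measurable_fun setT (fun w : Omega R => (w : int -> L R) n).
Proof.
move=> _ B mB; rewrite setTI; apply: sub_sigma_algebra.
by exists n, B.
Qed.

Lemma past_codeE w n :
  past_code w n = rev (mkseq (fun k => code ((w : int -> L R) k%:Z)) n).
Proof.
rewrite /past_code; elim: n => //= n ->.
by rewrite /mkseq -addn1 iotaD map_cat/= cats1 rev_rcons add0n.
Qed.

Lemma past_code_eq w n l : size l = n ->
  past_code w n = l <-> forall m, m \in map Posz (iota 0 n) ->
    code ((w : int -> L R) m) = nth [::] (rev l) `|m|%N.
Proof.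
move=> sl; rewrite past_codeE; split.
  move=> <- m /mapP[k]; rewrite mem_iota /= add0n => kn ->.
  by rewrite revK /= nth_mkseq.
move=> H; rewrite -(revK l); congr rev; apply: (@eq_from_nth _ [::]).
  by rewrite size_mkseq size_rev.
move=> k; rewrite size_mkseq => kn; rewrite nth_mkseq// H//.
by apply: map_f; rewrite mem_iota.
Qed.

Lemma size_past_code w n : size (past_code w n) = n.
Proof. by rewrite past_codeE size_rev size_mkseq. Qed.

Lemma measurable_past_code n (l : seq (seq nat)) :
  measurable [set w | past_code w n = l].
Proof.
elim: n l => [|n IH] [|c l] /=.
- by rewrite (_ : [set _ | _] = setT)//; apply/seteqP; split.
- by rewrite (_ : [set _ | _] = set0)//; apply/seteqP; split.
- by rewrite (_ : [set _ | _] = set0)//; apply/seteqP; split.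
rewrite (_ : [set _ | _] = (fun w : Omega R => (w : int -> L R) n%:Z) @^-1`
   [set x | code x = c] `&` [set w | past_code w n = l]).
  apply: measurableI => //; rewrite -[X in measurable X]setTI.
  by apply: measurable_coordinate => //; exact: measurable_code.
by apply/seteqP; split => w /=; [move=> [<- <-]|move=> [<- <-]].
Qed.

Section Law.
Variables (P : probability (Omega R) R) (mu : probability (L R) R).
Hypotheses (Pid : identically_distributed P mu)
  (Pind : independent_coordinates P).

Definition weight (c : seq nat) : R := fine (mu [set x | code x = c]).

Lemma weight_ge0 c : 0 <= weight c.
Proof. exact: fine_ge0. Qed.

Lemma weightE c : (weight c)%:E = mu [set x | code x = c].
Proof. by rewrite /weight fineK// fin_num_measure//; exact: measurable_code. Qed.

Lemma sum_weight_le1 (cs : seq (seq nat)) : uniq cs -> \sum_(c <- cs) weight c <= 1.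
Proof.
move=> ucs; rewrite -lee_fin -sumEFin.
under eq_bigr do rewrite weightE.
rewrite -(probability_mem_seq measurable_code)// probability_le1//.
exact: (measurable_countable_preimage measurable_code [set c | c \in cs]).
Qed.

Lemma probability_past_code n l : size l = n ->
  P [set w | past_code w n = l] = (\prod_(c <- l) weight c)%:E.
Proof.
move=> sl; pose B (m : int) := [set x : L R | code x = nth [::] (rev l) `|m|%N].
have us : uniq (map Posz (iota 0 n)) by rewrite map_inj_uniq ?iota_uniq// => i j [].
have mB m : measurable (B m) by exact: measurable_code.
transitivity (P [set w | forall m, m \in map Posz (iota 0 n) ->
    B m ((w : int -> L R) m)]).
  by congr (P _); apply/seteqP; split => w /=; rewrite past_code_eq.
rewrite (Pind us mB).
rewrite big_map.
have -> : \prod_(c <- l) weight c = \prod_(c <- rev l) weight c by rewrite big_rev.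
under eq_bigr => k _.
  rewrite (Pid k%:Z (mB k%:Z)) -weightE /=; over.
by rewrite prodEFin [in RHS](big_nth [::]) /index_iota subn0 size_rev sl.
Qed.

Fixpoint words (cs : seq (seq nat)) (n : nat) : seq (seq (seq nat)) :=
  if n is m.+1 then [seq c :: l | c <- cs, l <- words cs m] else [:: [::]].

Lemma uniq_words cs n : uniq cs -> uniq (words cs n).
Proof.
move=> ucs; elim: n => //= n IH.
by apply: allpairs_uniq => // -[c l] [c' l'] _ _ /= [-> ->].
Qed.

Lemma mem_words cs n l : (l \in words cs n) = (size l == n) && all (mem cs) l.
Proof.
elim: n l => [|n IH] [|c l] //=.
  by apply/negbTE/negP => /allpairsP[[? ?] [_ _ []]].
rewrite eqSS andbCA -IH; apply/allpairsP/idP => [[[c' l'] /= [? ? [-> ->]]]|/andP[? ?]].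
  exact/andP.
by exists (c, l).
Qed.

Lemma Ex_words cs n F :
  Ex cs weight n F = \sum_(l <- words cs n) (\prod_(c <- l) weight c) * F l.
Proof.
elim: n F => [|n IH] F /=; first by rewrite big_seq1 big_nil mul1r.
rewrite big_allpairs_dep; apply: eq_bigr => c _; rewrite IH mulr_sumr.
by apply: eq_bigr => l _; rewrite big_cons mulrA.
Qed.

Lemma probability_past_code_Ex cs n (b : pred (seq (seq nat))) : uniq cs ->
  P [set w | all (mem cs) (past_code w n) && b (past_code w n)] =
  (Ex cs weight n (fun l => (b l)%:R))%:E.
Proof.
move=> ucs; have -> : [set w | all (mem cs) (past_code w n) && b (past_code w n)] =
    [set w | past_code w n \in [seq l <- words cs n | b l]].
  apply/seteqP; split => w /=; rewrite mem_filter mem_words size_past_code eqxx /= andbC//.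
rewrite (probability_mem_seq (measurable_past_code n)); last first.
  by rewrite filter_uniq// uniq_words.
rewrite Ex_words -sumEFin big_filter big_mkcond /= big_seq [RHS]big_seq.
apply: eq_bigr => l; rewrite mem_words => /andP[/eqP sl _].
by case: (b l); rewrite ?mulr0// mulr1 probability_past_code.
Qed.

(** [Ex_hits_le] applies to the draws from a finite set [cs] of codes; the codes
    being countable, such sets exhaust the event. *)
Theorem probability_hits_le (S : Type) (step : S -> nat -> S) (bad : pred S)
    (u : S -> R) (s : S) (n : nat) :
  (forall s, 0 <= u s) -> (forall s, bad s -> 1 <= u s) ->
  (forall s cs, ~~ bad s -> uniq cs ->
    \sum_(c <- cs) weight c * \sum_(x <- c) u (step s x) <= u s) ->
  (P [set w | hits step bad s (marks 0 (past_code w n))] <= (u s)%:E)%E.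
Proof.
move=> u0 ubad usuper.
pose cs m : seq (seq nat) := undup (pmap unpickle (iota 0 m)).
have cs_pickle m c : (pickle c < m)%N -> c \in cs m.
  move=> cm; rewrite mem_undup mem_pmap; apply/mapP; exists (pickle c).
    by rewrite mem_iota.
  by rewrite pickleK.
have cs_sub m m' c : (m <= m')%N -> c \in cs m -> c \in cs m'.
  move=> mm'; rewrite !mem_undup !mem_pmap => /mapP[k]; rewrite mem_iota => km ->.
  by apply: map_f; rewrite mem_iota (leq_trans _ mm').
pose E m := [set w | all (mem (cs m)) (past_code w n) &&
   hits step bad s (marks 0 (past_code w n))].
have mE m : measurable (E m).
  apply: (measurable_countable_preimage (measurable_past_code n)
    [set l | all (mem (cs m)) l && hits step bad s (marks 0 l)]).
have -> : [set w | hits step bad s (marks 0 (past_code w n))] = \bigcup_m E m.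
  apply/seteqP; split => w /=; last by move=> [m _ /andP[]].
  move=> hw; exists (\max_(c <- past_code w n) (pickle c).+1) => //.
  rewrite /E /= hw andbT; apply/allP => c cw /=; apply: cs_pickle.
  by apply: (@leq_bigmax_seq _ _ xpredT (fun c => (pickle c).+1)).
have : P (E m) @[m --> \oo] --> P (\bigcup_m E m).
  apply: nondecreasing_cvg_mu => //; first exact: bigcupT_measurable.
  move=> m m' mm'; apply/subsetPset => w /andP[/allP cw hw]; apply/andP; split => //.
  by apply/allP => c /cw /=; exact: cs_sub.
move/cvg_lim => <-//; apply: lime_le.
  apply: ereal_nondecreasing_is_cvgn => m m' mm'; apply: le_measure; rewrite ?inE//.
  move=> w /andP[/allP cw hw]; apply/andP; split => //.
  by apply/allP => c /cw /=; exact: cs_sub.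
apply: nearW => m; rewrite (@probability_past_code_Ex (cs m) n
  (fun l => hits step bad s (marks 0 l)) (undup_uniq _)) lee_fin.
apply: Ex_hits_le => //; first exact: weight_ge0.
  exact/sum_weight_le1/undup_uniq.
by move=> s' bs'; apply: usuper => //; exact: undup_uniq.
Qed.

End Law.
End Codes.

(** * Measurability and rounding of the heights *)

Section Heights.
Context {R : realType}.

Lemma cell_bounds (eta x : R) : 0 < eta -> 0 <= x ->
  0 <= x - (cell eta x)%:R * eta <= eta.
Proof.
move=> eta0 x0; have /andP[h1 h2] : (cell eta x)%:R <= x / eta < (cell eta x).+1%:R.
  by apply: truncn_itv; rewrite divr_ge0// ltW.
rewrite subr_ge0 -ler_pdivlMr// h1 /= lerBlDl.
rewrite -[X in _ + X]mul1r -mulrDl natr1 -ler_pdivrMr//; exact: ltW.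
Qed.

Lemma mem_marks (A : eqType) (x : A) r (l : seq (seq A)) :
  x \in marks r l -> exists2 c, c \in l & x \in c.
Proof.
elim: l r => //= c l IH r; case E : (drop r c) => [|y d].
  by move=> /IH[c' c'l xc']; exists c' => //; rewrite inE c'l orbT.
rewrite inE => /predU1P[->|/IH[c' c'l xc']].
  by exists c; rewrite ?mem_head// (@mem_drop r)// E mem_head.
by exists c' => //; rewrite inE c'l orbT.
Qed.

Lemma marks_past_gt0 (w : Omega R) n x : x \in marks 0 (past w n) -> 0 < x.
Proof.
move=> /mem_marks[c cw xc]; elim: n cw => //= n IH; rewrite inE => /predU1P[cE|/IH//].
by move: xc; rewrite cE; case: (children _) => s /= /andP[_ /allP]; exact.
Qed.

Lemma genealogical_height_code (eta : R) (w : Omega R) n :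
  genealogical_height w n = (size (marks 0 (past_code eta w n)))%:R.
Proof. by rewrite genealogical_heightE map_marks size_map. Qed.

(** Rounding costs at most [eta] per mark. *)
Lemma chronological_height_code (eta : R) (w : Omega R) n : 0 < eta ->
  0 <= chronological_height w n -
       (\sum_(k <- marks 0 (past_code eta w n)) k%:R) * eta
    <= eta * genealogical_height w n.
Proof.
move=> eta0; rewrite chronological_heightE genealogical_heightE map_marks big_map.
have := @marks_past_gt0 w n; elim: marks => [|x s IH] H.
  by rewrite !big_nil mul0r subrr mulr0 lexx.
have /andP[s1 s2] : 0 <= \sum_(j <- s) j - (\sum_(j <- s) (cell eta j)%:R) * eta
    <= eta * (size s)%:R.
  by apply: IH => y ys; apply: H; rewrite inE ys orbT.
have /andP[h1 h2] := cell_bounds eta0 (ltW (H x (mem_head _ _))).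
rewrite !big_cons mulrDl opprD addrACA addr_ge0//=.
by rewrite -[(size (x :: s))%:R]natr1 mulrDr mulr1 addrC lerD.
Qed.

Lemma genealogical_height_ge0 (w : Omega R) n : 0 <= genealogical_height w n.
Proof. by rewrite genealogical_heightE. Qed.

Lemma chronological_height_ge0 (w : Omega R) n : 0 <= chronological_height w n.
Proof. by apply: sumr_ge0 => nu _; exact: psup_ge0. Qed.

Lemma measurable_genealogical_height n :
  measurable_fun setT (fun w : Omega R => genealogical_height w n).
Proof.
have -> : (fun w : Omega R => genealogical_height w n) =
    (fun l => (size (marks 0 l))%:R : R) \o (fun w => past_code 1 w n).
  by apply/funext => w; exact: genealogical_height_code.
exact: (measurable_fun_countable (measurable_past_code (@ltr01 R) n)
  (fun l => (size (marks 0 l))%:R : R)).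
Qed.

Lemma measurable_chronological_height n :
  measurable_fun setT (fun w : Omega R => chronological_height w n).
Proof.
pose eta m : R := m.+1%:R^-1; have eta0 m : 0 < eta m by rewrite invr_gt0.
apply: (@measurable_realfun.measurable_fun_cvg _ _ _ _ (fun m w =>
  (\sum_(k <- marks 0 (past_code (eta m) w n)) k%:R) * eta m)) => [m|w _].
  exact: (measurable_fun_countable (measurable_past_code (eta0 m) n)
    (fun l => (\sum_(k <- marks 0 l) k%:R) * eta m)).
apply: (@squeeze_cvgr _ _ _ _ (fun m => chronological_height w n -
  eta m * genealogical_height w n) (fun=> chronological_height w n)).
- apply: nearW => m; have /andP[] := chronological_height_code w n (eta0 m).
  by rewrite subr_ge0 lerBlDl => -> h; rewrite lerBlDr h.
- rewrite -[X in _ --> X]subr0 -(mul0r (genealogical_height w n)).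
  apply: cvgB; first exact: cvg_cst.
  apply: cvgM; last exact: cvg_cst.
  exact: cvg_harmonic.
- exact: cvg_cst.
Qed.

End Heights.

(** * The law of a mark *)

Section SumIntegral.
Local Open Scope ereal_scope.
Context d (T : measurableType d) (R : realType) (P : probability T R).
Context (C : countType) (X : T -> C).
Hypothesis mX : forall c, measurable [set t | X t = c].

Lemma sum_fibers_le_integral (h : C -> R) (D : set T) (s : seq C) :
  measurable D -> uniq s -> (forall c, (0 <= h c)%R) ->
  (forall c, c \in s -> [set t | X t = c] `<=` D) ->
  \sum_(c <- s) (h c)%:E * P [set t | X t = c] <= \int[P]_(t in D) (h (X t))%:E.
Proof.
move=> mD us h0 sD.
have mh A : measurable_fun A (fun t => (h (X t))%:E).
  apply: measurable_funTS.
  exact: (measurable_fun_countable mX (fun c => (h c)%:E)).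
have mS (s' : seq C) : measurable [set t | X t \in s'].
  exact: (measurable_countable_preimage mX [set c | c \in s']).
apply: (@le_trans _ _ (\int[P]_(t in [set t | X t \in s]) (h (X t))%:E)).
  elim: s us {sD} => [_|c s IH /= /andP[cs us]].
    by rewrite big_nil integral_ge0// => t _; rewrite lee_fin.
  rewrite big_cons (_ : [set t | _ \in c :: s] =
    [set t | X t = c] `|` [set t | X t \in s]); last first.
    apply/seteqP; split => t /=; rewrite inE; first by move/predU1P.
    by move=> ?; exact/predU1P.
  rewrite ge0_integral_setU//=; last 2 first.
  - by move=> t _; rewrite lee_fin.
  - apply/disj_setPS => t /= [-> ]; by rewrite (negbTE cs).
  rewrite leeD ?IH//.
  rewrite (eq_integral (cst (h c)%:E)); last by move=> t; rewrite inE /= => ->.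
  by rewrite integral_cst.
apply: ge0_subset_integral => //; first by move=> t _; rewrite lee_fin.
by move=> t /= /sD; exact.
Qed.

End SumIntegral.

Section MarkLaw.
Context {R : realType} d (T : measurableType d) (Pr : probability T R)
  (VP : {RV Pr >-> L R}).
Context dY (TY : measurableType dY) (PrY : probability TY R) (Y : {RV PrY >-> R}).
Variable eta : R.
Hypothesis eta0 : 0 < eta.
Hypothesis m01 : (0 < mean_mass Pr (fun w => children (VP w)) <= 1)%E.
Hypothesis hY : has_Ystar_law Pr (fun w => children (VP w)) PrY Y.

Let X (w : T) : seq nat := code eta (VP w).

Let mX c : measurable [set w | X w = c].
Proof.
exact: (measurable_funPTI VP (measurable_code eta0 c)).
Qed.

Let mean := fine (mean_mass Pr (fun w => children (VP w))).

Let mean01 : 0 < mean <= 1.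
Proof.
case/andP: m01 => m0 m1; rewrite /mean -lee_fin -lte_fin fineK ?m0//.
by rewrite ge0_fin_numE ?(le_lt_trans m1) ?ltry// ltW.
Qed.

Lemma cell_eq0 x : x <= 0 -> cell eta x = 0%N.
Proof.
move=> x0; apply/truncn0Pn; rewrite -ltNge (@le_lt_trans _ _ 0)//.
by rewrite mulr_le0_ge0// invr_ge0 ltW.
Qed.

Lemma measurable_cell_fun : measurable_fun setT (cell eta).
Proof.
move=> _ B mB; rewrite setTI.
apply: (@measurable_countable_preimage _ _ _ (cell eta)) => k.
have -> : [set t | cell eta t = k] = [set y | 0 < y /\ cell eta y = k] `|`
    (if k == 0%N then `]-oo, 0]%classic else set0).
  apply/seteqP; split => y /=.
    move=> yk; have [y0|y0] := ltP 0 y; first by left.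
    by right; rewrite -yk cell_eq0//= in_itv.
  case=> [[]//|]; case: eqP => // ->; rewrite /= in_itv /=; exact: cell_eq0.
apply: measurableU; first exact: measurable_cell.
by case: ifP => _; [exact: measurable_itv|exact: measurable0].
Qed.

(* also when there are at most [r] atoms, as both sides are then zero *)
Let cell_psup r w :
  cell eta (psup (remove r (children (VP w)))) = nth 0%N (X w) r.
Proof.
rewrite psup_head /= /X /code -nth0 nth_drop addn0.
have [rs|rs] := ltnP r (size (children (VP w))); first by rewrite (nth_map 0).
by rewrite !nth_default ?size_map// /cell mul0r truncn0.
Qed.

Section BoundedTest.
Variables (g : nat -> R) (M : R).
Hypotheses (g0 : forall k, 0 <= g k) (gM : forall k, g k <= M).

Let A k := [set w | mass (children (VP w)) = k].

Let mA k : measurable (A k).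
Proof.
have -> : A k = X @^-1` [set c | size c = k].
  by apply/seteqP; split => w /=; rewrite /X /code size_map.
exact: measurable_countable_preimage.
Qed.

Let term (k r : nat) : R := k%:R^-1 *
  cond_expectation Pr (fun w => g (cell eta (psup (remove r (children (VP w)))))) (A k) *
  (k%:R * fine (Pr (A k)) / mean).

Let I k r := (\int[Pr]_(w in A k) (g (nth 0%N (X w) r))%:E)%E.

Let I_ge0 k r : (0 <= I k r)%E.
Proof. by apply: integral_ge0 => w _; rewrite lee_fin. Qed.

Let I_le k r : (I k r <= M%:E * Pr (A k))%E.
Proof.
rewrite -integral_cst//; apply: ge0_le_integral => //.
- by move=> w _; rewrite lee_fin.
- apply: measurable_funTS.
  exact: (measurable_fun_countable mX (fun c => (g (nth 0%N c r))%:E)).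
- by move=> w _; rewrite lee_fin.
Qed.

Let I_fin k r : I k r \is a fin_num.
Proof.
rewrite ge0_fin_numE//; apply: (le_lt_trans (I_le k r)).
by rewrite ltey_eq fin_numM// fin_num_measure.
Qed.

(* if the event [A k] is null, both its conditional expectation and [I k r] are 0 *)
Let le_term k r : (0 < k)%N -> fine (I k r) <= term k r.
Proof.
move=> k0; rewrite /term /cond_expectation /Rintegral.
under eq_integral do rewrite cell_psup.
rewrite -/(I k r); case/andP: mean01 => m0 m1.
have k0' : k%:R != 0 :> R by rewrite pnatr_eq0 -lt0n.
have i0 : 0 <= fine (I k r) by exact: fine_ge0.
have [p0|p0] := eqVneq (fine (Pr (A k))) 0.
  rewrite p0 mulr0 mul0r mulr0 -lee_fin fineK// (le_trans (I_le k r))//.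
  by rewrite -(@fineK _ (Pr (A k))) ?fin_num_measure// p0 mule0.
have -> : k%:R^-1 * (fine (I k r) / fine (Pr (A k))) *
   (k%:R * fine (Pr (A k)) / mean) = fine (I k r) / mean.
  by field; rewrite p0 k0' gt_eqF.
by rewrite ler_pdivlMr// ler_piMr.
Qed.

Lemma bounded_sum_weight_le_Ystar (cs : seq (seq nat)) : uniq cs ->
  \sum_(c <- cs) weight eta (distribution Pr VP) c * \sum_(x <- c) g x <=
  fine ('E_PrY[fun w => g (cell eta (Y w))])%E.
Proof.
move=> ucs.
have mg : measurable_fun setT (g \o cell eta).
  by apply: (measurableT_comp _ measurable_cell_fun).
have bg : exists M', forall x, `|(g \o cell eta) x| <= M'.
  by exists M => x /=; rewrite ger0_norm.
have H := hY mg bg; have /cvg_lim <- := H; last exact: Rhausdorff.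
apply: limr_ge; first by apply/cvg_ex; eexists; exact: H.
exists (\max_(c <- cs) (size c)).+1 => // n /= Nn.
have sizen c : c \in cs -> (size c < n)%N.
  move=> cc; apply: leq_trans Nn; rewrite ltnS.
  exact: (@leq_bigmax_seq _ _ xpredT size).
apply: (@le_trans _ _ (\sum_(1 <= k < n) \sum_(0 <= r < k) fine (I k r))); last first.
  rewrite [leLHS]big_nat [leRHS]big_nat; apply: ler_sum => k /andP[k0 _].
  by apply: ler_sum => r _; exact: le_term.
pose w c := weight eta (distribution Pr VP) c.
have -> : \sum_(c <- cs) w c * \sum_(x <- c) g x = \sum_(1 <= k < n)
    \sum_(0 <= r < k) \sum_(c <- cs | size c == k) w c * g (nth 0%N c r).
  under [RHS]eq_bigr do (under eq_bigr do rewrite big_mkcond; rewrite exchange_big).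
  rewrite exchange_big /= big_seq [RHS]big_seq; apply: eq_bigr => c cc.
  transitivity (\sum_(1 <= k < n | k == size c) w c * \sum_(0 <= r < k) g (nth 0%N c r)).
    rewrite big_nat1_eq (sizen _ cc) andbT; case: ifP => [_|].
      by rewrite [in LHS](big_nth 0%N).
    by case: c {cc} => // _; rewrite big_nil mulr0.
  rewrite big_mkcond; apply: eq_bigr => k _; rewrite eq_sym.
  by case: eqP => // _; [rewrite mulr_sumr|rewrite big1].
apply: ler_sum => k _; apply: ler_sum => r _.
rewrite -lee_fin fineK// -big_filter -sumEFin.
under eq_bigr do rewrite EFinM muleC weightE//.
apply: (sum_fibers_le_integral Pr mX (h := fun c => g (nth 0%N c r))) => //.
  exact: filter_uniq.
move=> c; rewrite mem_filter => /andP[/eqP <- _] t /= <-.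
by rewrite /X /code size_map.
Qed.

End BoundedTest.

(** In the law of [Y] the size-biasing factor cancels the uniform choice of a
    rank: every atom of the offspring measure is counted once, and the total is
    divided by the mean number of atoms, which is at most one. *)
Theorem sum_weight_le_Ystar (g : nat -> R) (cs : seq (seq nat)) :
  (forall k, 0 <= g k) -> uniq cs ->
  ((\sum_(c <- cs) weight eta (distribution Pr VP) c * \sum_(x <- c) g x)%:E <=
   'E_PrY[fun w => (g (cell eta (Y w)))%R])%E.
Proof.
move=> g0 ucs.
(* a bound of [g] on the finitely many entries of [cs], used to truncate [g] *)
pose M := \sum_(c <- cs) \sum_(x <- c) g x.
have M0 : 0 <= M by apply: sumr_ge0 => c _; exact: sumr_ge0.
pose G k := Num.min (g k) M.
have G0 k : 0 <= G k by rewrite le_min g0.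
have GM k : G k <= M by rewrite ge_min lexx orbT.
have -> : \sum_(c <- cs) weight eta (distribution Pr VP) c * \sum_(x <- c) g x =
          \sum_(c <- cs) weight eta (distribution Pr VP) c * \sum_(x <- c) G x.
  rewrite big_seq [RHS]big_seq; apply: eq_bigr => c cc; congr (_ * _).
  rewrite big_seq [RHS]big_seq; apply: eq_bigr => x xc; apply/esym/min_idPl.
  rewrite /M (big_rem c)//= (big_rem x)//= -addrA ler_wpDr// addr_ge0//.
    exact: sumr_ge0.
  by apply: sumr_ge0 => ? _; exact: sumr_ge0.
have mc (f : nat -> R) : measurable_fun setT (fun w => (f (cell eta (Y w)))%:E).
  apply/measurable_EFinP; apply: (measurableT_comp (_ : measurable_fun setT (f \o cell eta))) => //.
  exact: (measurableT_comp _ measurable_cell_fun).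
have GE : ('E_PrY[fun w => G (cell eta (Y w))])%E \is a fin_num.
  rewrite unlock ge0_fin_numE ?integral_ge0//; last by move=> w _; rewrite lee_fin.
  apply: (@le_lt_trans _ _ (\int[PrY]_(w in setT) (cst M%:E w))%E).
    by apply: ge0_le_integral => //; move=> w _; rewrite lee_fin.
  rewrite integral_cst//.
  by rewrite ltey_eq fin_numM// fin_num_measure.
apply: (@le_trans _ _ ('E_PrY[fun w => G (cell eta (Y w))])%E).
  by rewrite -(fineK GE) lee_fin; exact: (bounded_sum_weight_le_Ystar G0 GM ucs).
rewrite unlock; apply: ge0_le_integral => //.
- by move=> w _; rewrite lee_fin.
- by move=> w _; rewrite lee_fin /G ge_min lexx.
Qed.

Lemma Ystar_ge0 : PrY [set w | Y w < 0] = 0%E.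
Proof.
have mA : measurable [set w | Y w < 0].
  have -> : [set w | Y w < 0] = Y @^-1` `]-oo, 0[.
    by apply/seteqP; split => w /=; rewrite in_itv.
  exact: (measurable_funPTI Y (measurable_itv _)).
have mf : measurable_fun setT (\1_(`]-oo, 0[) : R -> R).
  exact: measurable_indic.
have bf : exists M, forall x, `|(\1_(`]-oo, 0[) : R -> R) x| <= M.
  by exists 1 => x; rewrite indicE ger0_norm// lern1 leq_b1.
have := hY mf bf.
rewrite (_ : (fun n => _) = fun=> 0); last first.
  apply/funext => n; rewrite big1// => k _; rewrite big1// => r _.
  rewrite /cond_expectation /Rintegral integral0_eq ?mul0r ?mulr0 ?mul0r//.
  by move=> w _; rewrite indicE memNset//= in_itv/= ltNge psup_ge0.
move/cvg_lim => /(_ (@Rhausdorff _)); rewrite lim_cst// => /esym.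
rewrite unlock (_ : (\int[PrY]_w _)%E = PrY [set w | Y w < 0]) => [E|].
  by rewrite -[LHS]fineK ?fin_num_measure// E.
rewrite -[X in PrY X]setIT -integral_indic//.
Qed.

End MarkLaw.

(** * A non-asymptotic comparison of the two heights *)

Lemma le_truncated_excess (R : realType) (y z t e : R) : 0 <= e -> y <= z + e ->
  y <= Num.min z t + Num.max (y - t) 0 + e.
Proof. by case: (leP z t); case: (leP (y - t) 0) => *; lra. Qed.

Section StarMean.
Context {R : realType} dY (TY : measurableType dY) (PrY : probability TY R)
  (Y : {RV PrY >-> R}).
Hypotheses (Y0 : PrY [set w | Y w < 0] = 0%E) (EY : ('E_PrY[Y] < +oo)%E).
Variables (eta M : R).
Hypotheses (eta0 : 0 < eta).

(* [Y] is nonnegative almost surely only; [Yp] is everywhere and has the same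
   rounding *)
Let Yp w := Num.max (Y w) 0.
Let a := fine ('E_PrY[Y])%E.
Let t := a + M.
Let tr (k : nat) := Num.min (k%:R * eta) t.
Let excess (k : nat) := Num.max (k%:R * eta - t) 0.
Let kappa := \int[PrY]_w Num.max (Y w - a - M) 0.
Let beta := \int[PrY]_w tr (cell eta (Y w)).

Let Yp_ge0 w : 0 <= Yp w. Proof. by rewrite /Yp le_max lexx orbT. Qed.

Let measurable_Yp : measurable_fun setT Yp.
Proof. by apply: measurable_maxr. Qed.

Let integral_Yp : (\int[PrY]_w (Yp w)%:E = 'E_PrY[Y])%E.
Proof.
rewrite unlock; apply: ae_eq_integral => //; try exact/measurable_EFinP.
exists [set w | Y w < 0]; split => //.
  have -> : [set w | Y w < 0] = Y @^-1` `]-oo, 0[.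
    by apply/seteqP; split => w /=; rewrite in_itv.
  exact: (measurable_funPTI Y (measurable_itv _)).
move=> w /=; apply: contra_notP => /negP; rewrite -leNgt => Yw _.
by rewrite /Yp (max_idPl _).
Qed.

Let integrable_Yp : PrY.-integrable setT (EFin \o Yp).
Proof.
apply/integrableP; split; first exact/measurable_EFinP.
under eq_integral do rewrite /= ger0_norm//.
by rewrite integral_Yp.
Qed.

Let mean_Yp : \int[PrY]_w Yp w = a.
Proof. by rewrite /Rintegral integral_Yp. Qed.

Lemma Ystar_mean_ge0 : 0 <= a.
Proof. by rewrite -mean_Yp; apply: Rintegral_ge0 => // w _; exact: Yp_ge0. Qed.

Let a0 := Ystar_mean_ge0.

Hypothesis M0 : 0 <= M.

Let t0 : 0 <= t. Proof. exact: addr_ge0. Qed.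

Let integrable_le (X : TY -> R) : measurable_fun setT X -> (forall w, 0 <= X w <= Yp w) ->
  PrY.-integrable setT (EFin \o X).
Proof.
move=> mX H; apply: (le_integrable _ _ _ integrable_Yp) => //.
  exact/measurable_EFinP.
move=> w _ /=; have /andP[h1 h2] := H w.
by rewrite lee_fin !ger0_norm.
Qed.

Let cell_pos w : cell eta (Y w) = cell eta (Yp w).
Proof.
by rewrite /Yp; case: (leP 0 (Y w)) => // /ltW Yw; rewrite !cell_eq0.
Qed.

Let cell_le w : 0 <= (cell eta (Y w))%:R * eta <= Yp w.
Proof.
rewrite mulr_ge0 ?(ltW eta0)//= cell_pos.
by have /andP[] := cell_bounds eta0 (Yp_ge0 w); rewrite subr_ge0.
Qed.

Let le_cell w : Yp w <= (cell eta (Y w))%:R * eta + eta.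
Proof.
rewrite cell_pos.
by have /andP[_] := cell_bounds eta0 (Yp_ge0 w); rewrite lerBlDl.
Qed.

Let mcell (f : nat -> R) : measurable_fun setT (fun w => f (cell eta (Y w))).
Proof.
apply: (measurableT_comp (_ : measurable_fun setT (f \o cell eta))) => //.
exact: (measurableT_comp _ (measurable_cell_fun eta0)).
Qed.

Let integrable_tr : PrY.-integrable setT (EFin \o (fun w => tr (cell eta (Y w)))).
Proof.
apply: integrable_le => [|w]; first exact: mcell.
have /andP[h1 h2] := cell_le w.
by rewrite /tr le_min h1 t0/= ge_min h2.
Qed.

Let integrable_excess : PrY.-integrable setT (EFin \o (fun w => excess (cell eta (Y w)))).
Proof.
apply: integrable_le => [|w]; first exact: mcell.
have /andP[h1 h2] := cell_le w.
by rewrite /excess le_max lexx orbT/= ge_max Yp_ge0 andbT lerBlDr ler_wpDr.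
Qed.

Let kappaE : kappa = \int[PrY]_w Num.max (Yp w - t) 0.
Proof.
apply: eq_Rintegral => w _; rewrite -addrA -opprD -/t /Yp.
case: (leP 0 (Y w)) => // /ltW Yw.
by rewrite !(max_idPr _)// subr_le0// (le_trans Yw).
Qed.

Let integrable_far : PrY.-integrable setT (EFin \o (fun w => Num.max (Yp w - t) 0)).
Proof.
apply: integrable_le => [|w].
  by apply: measurable_maxr => //; apply: measurable_funB.
by rewrite le_max lexx orbT/= ge_max Yp_ge0 andbT lerBlDr ler_wpDr.
Qed.

Lemma mean_truncated_le : beta <= a.
Proof.
rewrite -mean_Yp; apply: le_Rintegral => // w _.
by rewrite /tr ge_min; have /andP[_ ->] := cell_le w.
Qed.

Let integrable_cst (r : R) : PrY.-integrable setT (EFin \o (fun=> r)).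
Proof. exact: finite_measure_integrable_cst. Qed.

Let Rint_cst (r : R) : \int[PrY]_w r = r.
Proof. rewrite -[RHS]mulr1 -[X in _ = _ * X]/(fine (1%E : \bar R)) -(probability_setT PrY).
exact: Rintegral_cst. Qed.

Lemma le_mean_truncated : a <= beta + kappa + eta.
Proof.
rewrite -mean_Yp kappaE -[X in _ + X]Rint_cst -!RintegralD//; last first.
  exact: (integrableD _ integrable_tr integrable_far).
apply: le_Rintegral => //.
  exact: (integrableD _ (integrableD _ integrable_tr integrable_far) (integrable_cst eta)).
by move=> w _; apply: le_truncated_excess; [exact: ltW|exact: le_cell].
Qed.

Lemma mean_excess_le : \int[PrY]_w excess (cell eta (Y w)) <= kappa.
Proof.
rewrite kappaE; apply: le_Rintegral => // w _; have /andP[_ h] := cell_le w.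
by rewrite /excess ge_max !le_max lexx orbT lerD2r h.
Qed.

Lemma truncated_dev_le k : (tr k - beta) ^+ 2 <= t ^+ 2.
Proof.
have b0 : 0 <= beta.
  by apply: Rintegral_ge0 => // w _; rewrite /tr le_min t0 mulr_ge0// ltW.
have bt : beta <= t.
  rewrite -[leRHS]Rint_cst; apply: le_Rintegral => // w _.
  by rewrite /tr ge_min lexx orbT.
have k0 : 0 <= tr k by rewrite /tr le_min t0 mulr_ge0// ltW.
have kt : tr k <= t by rewrite /tr ge_min lexx orbT.
rewrite -[leLHS]real_normK ?num_real// ler_sqr ?nnegrE// ler_norml.
by rewrite lerBrDr lerBlDr (le_trans _ k0) ?(ler_wpDr b0)// addrC subr_le0.
Qed.

(** The term in [B] is centred, so that it does not contribute to the bound. *)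
Lemma mean_affine_le (g : nat -> R) (A B D : R) : 0 <= D ->
  (forall k, 0 <= g k <= A + B * (tr k - beta) + D * excess k) ->
  ('E_PrY[fun w => g (cell eta (Y w))] <= (A + D * kappa)%:E)%E.
Proof.
move=> D0 H; pose G k := A + B * (tr k - beta) + D * excess k.
have iB : PrY.-integrable setT (EFin \o (fun w => B * (tr (cell eta (Y w)) - beta))).
  exact: (integrableZl measurableT B
    (integrableB measurableT integrable_tr (integrable_cst beta))).
have iD : PrY.-integrable setT (EFin \o (fun w => D * excess (cell eta (Y w)))).
  exact: (integrableZl measurableT D integrable_excess).
have iAB := integrableD measurableT (integrable_cst A) iB.
have iG := integrableD measurableT iAB iD.
apply: (@le_trans _ _ (\int[PrY]_w (G (cell eta (Y w)))%:E)%E).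
  rewrite unlock; apply: ge0_le_integral => //.
  - by move=> w _; rewrite lee_fin; have /andP[] := H (cell eta (Y w)).
  - exact/measurable_EFinP/mcell.
  - exact/measurable_EFinP/(mcell G).
  - by move=> w _; rewrite lee_fin; have /andP[] := H (cell eta (Y w)).
rewrite -(fineK (integrable_fin_num _ iG))// lee_fin.
rewrite -/(Rintegral _ _ _) RintegralD// RintegralD//.
rewrite !RintegralZl// ?RintegralB//; last exact: (integrableB measurableT integrable_tr (integrable_cst beta)).
rewrite !Rint_cst -/beta subrr mulr0 addr0 lerD2l.
by rewrite ler_wpM2l// mean_excess_le.
Qed.

End StarMean.

Lemma hits_last (S : Type) (A : eqType) (step : S -> A -> S) (bad : pred S) s xs :
  bad (foldl step s xs) -> hits step bad s xs.
Proof.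
elim: xs s => [|x xs IH] s /=; rewrite /hits /=; first by move=> ->.
by move=> /IH h; apply/orP; right.
Qed.

Lemma heights_deviation_le (R : realType) (c x z b a h n e k lam : R) :
  0 <= c - (x + z + b * h) <= e * h -> `|x| < lam -> `|z| < lam ->
  `|b - a| <= k + e -> 0 <= h -> h <= n -> 0 <= e -> 0 <= k ->
  `|c - a * h| <= 2 * lam + (2 * e + k) * n.
Proof.
move=> /andP[c1 c2]; rewrite !ltr_norml => /andP[x1 x2] /andP[z1 z2] ba h0 hn e0 k0.
have : `|(b - a) * h| <= (k + e) * n by rewrite normrM (ger0_norm h0) ler_pM.
have : e * h <= e * n by rewrite ler_wpM2l.
rewrite !ler_norml => ? /andP[? ?]; apply/andP; split; lra.
Qed.

Section Deviation.
Context {R : realType}.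
Variables (P : probability (Omega R) R).
Context d (T : measurableType d) (Pr : probability T R) (VP : {RV Pr >-> L R}).
Context dY (TY : measurableType dY) (PrY : probability TY R) (Y : {RV PrY >-> R}).
Hypothesis Pid : identically_distributed P (distribution Pr VP).
Hypothesis Pind : independent_coordinates P.
Hypothesis m01 : (0 < mean_mass Pr (fun w => children (VP w)) <= 1)%E.
Hypothesis hY : has_Ystar_law Pr (fun w => children (VP w)) PrY Y.
Hypothesis EY : ('E_PrY[Y] < +oo)%E.
Variables (eta lam M : R) (N n : nat).
Hypotheses (eta0 : 0 < eta) (lam0 : 0 < lam) (M0 : 0 <= M).

Let Y0 := Ystar_ge0 hY.
Let a := fine ('E_PrY[Y])%E.
Let t := a + M.
Let tr (k : nat) : R := Num.min (k%:R * eta) t.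
Let excess (k : nat) : R := Num.max (k%:R * eta - t) 0.
Let kappa := \int[PrY]_w Num.max (Y w - a - M) 0.
Let beta := \int[PrY]_w tr (cell eta (Y w)).

(* the number of marks, the sum of the truncated and centred marks, the sum of
   what the truncation cuts off *)
Let step (s : nat * R * R) (k : nat) : nat * R * R :=
  (s.1.1.+1, s.1.2 + (tr k - beta), s.2 + excess k).

Let bad : pred (nat * R * R) := fun s =>
  (s.1.1 <= N)%N && ((lam <= `|s.1.2|) || (lam <= `|s.2|)).

Let u (s : nat * R * R) : R :=
  if (s.1.1 <= N)%N then
    (s.1.2 ^+ 2 + (N - s.1.1)%:R * t ^+ 2) / lam ^+ 2 +
    (`|s.2| + (N - s.1.1)%:R * kappa) / lam
  else 0.

Let kappa0 : 0 <= kappa.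
Proof. by apply: Rintegral_ge0 => // w _; rewrite le_max lexx orbT. Qed.

Let nt_ge0 (j : nat) : 0 <= j%:R * t ^+ 2.
Proof. by apply: mulr_ge0 => //; exact: sqr_ge0. Qed.

Let nkappa_ge0 (j : nat) : 0 <= j%:R * kappa.
Proof. exact: mulr_ge0. Qed.

Let u_terms_ge0 (x z : R) (j : nat) :
  0 <= (x ^+ 2 + j%:R * t ^+ 2) / lam ^+ 2 /\ 0 <= (`|z| + j%:R * kappa) / lam.
Proof.
split; apply: divr_ge0; rewrite ?sqr_ge0 ?(ltW lam0)//; apply: addr_ge0 => //.
exact: sqr_ge0.
Qed.

Let u0 s : 0 <= u s.
Proof.
rewrite /u; case: ifP => // _.
by have [? ?] := u_terms_ge0 s.1.2 s.2 (N - s.1.1); exact: addr_ge0.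
Qed.

Let ubad s : bad s -> 1 <= u s.
Proof.
rewrite /bad /u => /andP[-> hs].
have [h1 h2] := u_terms_ge0 s.1.2 s.2 (N - s.1.1).
case/orP: hs => h.
- apply: ler_wpDr => //; rewrite ler_pdivlMr ?exprn_gt0// mul1r.
  apply: ler_wpDr => //.
  by rewrite -[leRHS]real_normK ?num_real// ler_sqr ?nnegrE// ltW.
- apply: ler_wpDl => //; rewrite ler_pdivlMr// mul1r.
  exact: ler_wpDr.
Qed.

Let excess_ge0 k : 0 <= excess k.
Proof. by rewrite /excess le_max lexx orbT. Qed.

Let usuper s cs : ~~ bad s -> uniq cs ->
  \sum_(c <- cs) weight eta (distribution Pr VP) c * \sum_(x <- c) u (step s x) <= u s.
Proof.
move=> _ ucs; rewrite -lee_fin.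
apply: le_trans (sum_weight_le_Ystar eta0 m01 hY (fun k => u0 (step s k)) ucs) _.
case: s => [[j x] z]; have [jN|Nj] := ltnP j N; last first.
  rewrite (_ : (fun w => u _) = fun=> 0); last first.
    by apply/funext => w; rewrite /u /= ltnNge Nj.
  by rewrite unlock integral0 lee_fin.
have NjE : (N - j)%:R = (N - j.+1)%:R + 1 :> R by rewrite natr1 -subSn.
pose A := (x ^+ 2 + (N - j)%:R * t ^+ 2) / lam ^+ 2 +
          (`|z| + (N - j.+1)%:R * kappa) / lam.
have -> : u (j, x, z) = A + lam^-1 * kappa.
  by rewrite /u /= (ltnW jN) /A NjE; ring.
have D0 : 0 <= lam^-1 by rewrite invr_ge0 ltW.
apply: (mean_affine_le Y0 EY eta0 M0 (g := fun k => u (step (j, x, z) k)) (A := A) (B := 2 * x / lam ^+ 2) D0) => k.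
rewrite u0 /= /u /= jN /A NjE.
have h1 := truncated_dev_le Y0 EY eta0 M0 k.
have h2 : `|z + excess k| <= `|z| + excess k.
  by rewrite (le_trans (ler_normD _ _))// (ger0_norm (excess_ge0 k)).
have h3 : (x + (tr k - beta)) ^+ 2 + (N - j.+1)%:R * t ^+ 2 <=
   x ^+ 2 + ((N - j.+1)%:R + 1) * t ^+ 2 + 2 * x * (tr k - beta).
  rewrite -subr_ge0 (_ : _ - _ = t ^+ 2 - (tr k - beta) ^+ 2); last by ring.
  by rewrite subr_ge0.
apply: (@le_trans _ _ ((x ^+ 2 + ((N - j.+1)%:R + 1) * t ^+ 2 + 2 * x * (tr k - beta)) / lam ^+ 2
   + (`|z| + excess k + (N - j.+1)%:R * kappa) / lam)).
  apply: lerD; rewrite ler_wpM2r ?invr_ge0 ?exprn_ge0 ?(ltW lam0)//.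
  by rewrite lerD2r.
rewrite le_eqVlt; apply/orP; left; apply/eqP; rewrite -/(excess k) -/(tr k) -/beta.
by ring.
Qed.

Let foldl_step xs s : foldl step s xs =
  ((s.1.1 + size xs)%N, s.1.2 + \sum_(k <- xs) (tr k - beta),
   s.2 + \sum_(k <- xs) excess k).
Proof.
elim: xs s => [|k xs IH] [[j x] z] /=; first by rewrite !big_nil addn0 !addr0.
by rewrite IH /= !big_cons !addrA addSnnS.
Qed.

(** Optional stopping with the potential
    [(x ^+ 2 + (N - j) * t ^+ 2) / lam ^+ 2 + (z + (N - j) * kappa) / lam], where
    [j] is the number of marks read, [x] the sum of the centred marks truncated
    at [t] and [z] the sum of what the truncation cuts off: a second moment bound
    for [x] and a first moment bound for [z].  If neither reaches [lam] within
    [N] marks, the heights differ by the centring, at most [kappa + eta] off per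
    mark, and by the rounding, at most [eta] per mark. *)
Theorem height_deviation :
  (P [set w | (genealogical_height w n <= N%:R /\
      2 * lam + (2 * eta + kappa) * N%:R <
        `|chronological_height w n - a * genealogical_height w n|)%R ] <=
   (N%:R * (a + M) ^+ 2 / lam ^+ 2 + N%:R * kappa / lam)%:E)%E.
Proof.
have mh := measurable_past_code eta0 n.
have -> : N%:R * (a + M) ^+ 2 / lam ^+ 2 + N%:R * kappa / lam = u (0%N, 0, 0).
  by rewrite /u /= subn0 expr0n normr0 !add0r.
apply: le_trans (probability_hits_le eta0 Pid Pind (0%N, 0, 0) n u0 ubad usuper).
apply: le_measure; rewrite ?inE.
- pose F (w : Omega R) := `|chronological_height w n - a * genealogical_height w n|.
  have mF : measurable_fun setT F.
    apply: measurableT_comp => //; apply: measurable_funB.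
      exact: measurable_chronological_height.
    by apply: measurable_funM => //; exact: measurable_genealogical_height.
  rewrite (_ : [set _ | _] = (fun w => genealogical_height w n) @^-1` `]-oo, N%:R] `&`
    F @^-1` `](2 * lam + (2 * eta + kappa) * N%:R), +oo[).
    apply: measurableI.
      rewrite -[X in measurable X]setTI.
      exact: (measurable_genealogical_height n measurableT (measurable_itv _)).
    rewrite -[X in measurable X]setTI; exact: (mF measurableT _ (measurable_itv _)).
  by apply/seteqP; split => w /=; rewrite !in_itv/= andbT.
- exact: (measurable_countable_preimage mh [set l | hits step bad (0%N, 0, 0) (marks 0 l)]).
move=> w /= [gN]; apply: contraPT => nhit; apply/negP; rewrite -leNgt.
have [c1 c2] := andP (chronological_height_code w n eta0).
move: nhit gN c1 c2; rewrite (genealogical_height_code eta).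
set xs := marks 0 _ => nhit; rewrite ler_nat => gN.
have : ~~ bad (foldl step (0%N, 0, 0) xs) by apply: contra nhit; exact: hits_last.
rewrite foldl_step /bad /= add0n gN /= negb_or -!ltNge !add0r => /andP[hx hz].
have E : (\sum_(k <- xs) k%:R) * eta =
    \sum_(k <- xs) (tr k - beta) + \sum_(k <- xs) excess k + beta * (size xs)%:R.
  rewrite mulr_suml -big_split/=.
  have -> : beta * (size xs)%:R = \sum_(k <- xs) beta.
    by rewrite big_const_seq count_predT iter_addr_0 mulr_natr.
  rewrite -big_split/=; apply: eq_bigr => k _.
  rewrite /tr /excess; move: (k%:R * eta) t beta => y t' b.
  by case: (leP y t') => h; [rewrite (max_idPr _) ?subr_le0//; ring|
    rewrite (max_idPl _) ?subr_ge0 ?(ltW h)//; ring].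
have b1 := mean_truncated_le Y0 EY eta0 M0.
have b2 := le_mean_truncated Y0 EY eta0 M0.
have {b1 b2} hb : `|beta - a| <= kappa + eta.
  rewrite -/beta -/a -/kappa in b1 b2; rewrite ler_norml; apply/andP; split.
    by rewrite lerNl opprB lerBlDl addrA.
  by rewrite lerBlDr (le_trans b1)// ler_wpDl// addr_ge0// ltW.
rewrite E => c1 c2.
have s0 : 0 <= (size xs)%:R :> R by [].
have sN : (size xs)%:R <= N%:R :> R by rewrite ler_nat.
apply: (heights_deviation_le (x := \sum_(k <- xs) (tr k - beta))
  (z := \sum_(k <- xs) excess k) (b := beta)) => //; last exact: ltW.
by rewrite c1 c2.
Qed.

End Deviation.

(** * Uniform integrability and tightness *)

Section Tails.
Context {R : realType}.

Lemma measurable_excess d (T : measurableType d) (X : T -> R) (M : R) :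
  measurable_fun setT X -> measurable_fun setT (fun w => Num.max (X w - M) 0).
Proof. by move=> mX; apply: measurable_maxr => //; exact: measurable_funB. Qed.

Lemma tail_cvg0 d (T : measurableType d) (P : probability T R) (X : {RV P >-> R}) :
  P.-integrable setT (EFin \o X) ->
  \int[P]_w Num.max (X w - m%:R) 0 @[m --> \oo] --> 0.
Proof.
move=> iX; rewrite -[0]/(fine (0 : \bar R)); apply: fine_cvg.
rewrite [X in _ --> X](_ : _ = (\int[P]_(w in setT) cst 0 w)%E); last by rewrite integral0.
apply: (@dominated_cvg _ _ _ _ _ measurableT
  (fun (m : nat) w => (Num.max (X w - m%:R) 0)%:E) (cst 0%E) (fun w => `|X w|%:E)).
- by move=> m; apply/measurable_EFinP/measurable_excess.
- move=> w _; apply: cvg_near_cst; near=> m.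
  rewrite (max_idPr _)// subr_le0 (le_trans (ler_norm _))//.
  by near: m; exact: nbhs_infty_ger.
- by [].
- by have := integrable_norm iX.
- move=> m w _ /=; rewrite lee_fin ger0_norm ?le_max ?lexx ?orbT//.
  by rewrite ge_max normr_ge0 andbT lerBlDr ler_wpDr// ler_norm.
Unshelve. all: by end_near. Qed.

(** Convergence of the laws and of the means of the positive parts gives
    convergence of the means of [max (X - M) 0], since [max x 0 - max (x - M) 0],
    which is [min (max x 0) M], is bounded and continuous.  The limits are small
    for large [M]. *)
Lemma near_tail_le (d : nat -> measure_display) (T : forall p, measurableType (d p))
    (P : forall p, probability (T p) R) (X : forall p, T p -> R)
    d' (T' : measurableType d') (P' : probability T' R) (X' : {RV P' >-> R}) (e : R) :
  (forall p, measurable_fun setT (X p)) ->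
  P'.-integrable setT (EFin \o X') ->
  cvg_in_law P X P' (X' : T' -> R) ->
  ('E_(P p)[(fun w => Num.max (X p w) 0)%R] @[p --> \oo] -->
   'E_P'[(fun w => Num.max (X' w) 0)%R])%E ->
  0 < e -> exists2 M, 0 <= M &
    \forall p \near \oo, \int[P p]_w Num.max (X p w - M) 0 <= e.
Proof.
move=> mX iX' lawX posX e0.
have := tail_cvg0 iX' => /cvgrPdist_lt/(_ _ (divr_gt0 e0 (ltr0Sn _ 1))) [m _ /(_ m (leqnn m))/=].
set k := \int[P']_w _ => km.
have k2 : k < e / 2.
  by move: km; rewrite sub0r normrN; apply: le_lt_trans; exact: ler_norm.
exists m%:R => //.
pose f x : R := Num.min (Num.max x 0) m%:R.
have cf : continuous f.
  move=> x; apply: (@continuous_min R R (fun x => Num.max x 0) (cst m%:R)).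
    apply: (@continuous_max R R id (cst 0)); [exact: cvg_id|exact: cvg_cst].
  exact: cvg_cst.
have f01 x : 0 <= f x <= m%:R.
  by rewrite le_min le_max lexx orbT ler0n/= ge_min lexx orbT.
have bf : exists M, forall x, `|f x| <= M.
  by exists m%:R => x; have /andP[h1 h2] := f01 x; rewrite ger0_norm.
have excessE x : Num.max (x - m%:R) 0 = Num.max x 0 - f x.
  have m0 : 0 <= m%:R :> R by [].
  rewrite /f; case: (leP x 0) => x0; case: (leP (x - m%:R) 0) => h.
  - by rewrite (min_idPl _)// subrr.
  - by exfalso; lra.
  - by rewrite (min_idPl _) ?subrr// -subr_le0.
  - by rewrite (min_idPr _)// -subr_ge0 ltW.
have bnd d0 (T0 : measurableType d0) (P0 : probability T0 R) (X0 : T0 -> R) :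
  measurable_fun setT X0 -> P0.-integrable setT (EFin \o (f \o X0)).
  move=> mX0; apply: (@le_integrable _ _ _ P0 setT measurableT _ (EFin \o cst m%:R)); last first.
  - exact: finite_measure_integrable_cst.
  - by move=> w _ /=; rewrite lee_fin !ger0_norm//; have /andP[] := f01 (X0 w).
  - apply/measurable_EFinP; apply: measurableT_comp => //.
    exact: continuous_measurable_fun.
have pos d0 (T0 : measurableType d0) (P0 : probability T0 R) (X0 : T0 -> R) :
  measurable_fun setT X0 -> ('E_P0[(fun w => Num.max (X0 w) 0)%R] < +oo)%E ->
  \int[P0]_w Num.max (X0 w - m%:R) 0 =
  fine ('E_P0[(fun w => Num.max (X0 w) 0)%R])%E - fine ('E_P0[f \o X0])%E.
  move=> mX0 fX0; rewrite unlock -RintegralB//; last 2 first.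
  - apply/integrableP; split.
      by apply/measurable_EFinP; exact: measurable_maxr.
    apply: le_lt_trans fX0; rewrite unlock; apply: ge0_le_integral => //.
    + by apply: measurableT_comp => //; apply/measurable_EFinP; exact: measurable_maxr.
    + by apply/measurable_EFinP; exact: measurable_maxr.
    + by move=> w _ /=; rewrite lee_fin ger0_norm// le_max lexx orbT.
  - exact: bnd.
  by apply: eq_Rintegral => w _; exact: excessE.
have fin' : ('E_P'[(fun w => Num.max (X' w) 0)%R] < +oo)%E.
  have /integrableP[_] := iX'; apply: le_lt_trans.
  rewrite unlock; apply: ge0_le_integral => //.
  - by move=> w _; rewrite lee_fin le_max lexx orbT.
  - by apply/measurable_EFinP; exact: measurable_maxr.
  - by do 2 apply: measurableT_comp => //.
  - by move=> w _ /=; rewrite lee_fin ge_max normr_ge0 ler_norm.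
have ge0' : (0 <= 'E_P'[(fun w => Num.max (X' w) 0)%R])%E.
  by rewrite unlock; apply: integral_ge0 => w _; rewrite lee_fin le_max lexx orbT.
have kE : k = _ := pos _ _ P' X' (measurable_funPT X') fin'.
have finf : ('E_P'[f \o X'])%E \is a fin_num.
  by rewrite unlock; apply: integrable_fin_num => //; exact: bnd.
have := lawX f cf bf; rewrite -(fineK finf) => /fine_cvg cvf.
have fin1 : ('E_P'[(fun w => Num.max (X' w) 0)%R])%E \is a fin_num.
  by rewrite ge0_fin_numE.
move: posX; rewrite -(fineK fin1) => /fine_cvgP[finp cvp].
have ke : k < e by lra.
have := cvgr_le _ (cvgB cvp cvf) e; rewrite -kE => /(_ _ _ ke) nle.
near=> p.
rewrite pos//; last first.
  have : ('E_(P p)[(fun w => Num.max (X p w) 0)%R])%E \is a fin_num by near: p.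
  by rewrite fin_numE => /andP[_]; rewrite ltey.
near: p; exact: nle.
Unshelve. all: by end_near. Qed.

End Tails.

Section Tightness.
Context {R : realType} (d : nat -> measure_display)
  (T : forall p, measurableType (d p)) (P : forall p, probability (T p) R)
  (X : forall p, T p -> R -> R)
  (d' : measure_display) (T' : measurableType d') (P' : probability T' R)
  (X' : T' -> R -> R).
Arguments X : clear implicits.
Hypotheses (mX : forall p (t : R), 0 <= t -> measurable_fun setT (fun w => X p w t))
  (mX' : forall t : R, 0 <= t -> measurable_fun setT (fun w => X' w t)).

Lemma mean_ramp_cvg0 t : 0 <= t ->
  ('E_P'[fun w => ramp m%:R 0 (X' w t)] @[m --> \oo] --> 0)%E.
Proof.
move=> t0; rewrite unlock.
rewrite [X in _ --> X](_ : _ = (\int[P']_(w in setT) cst 0 w)%E); last by rewrite integral0.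
apply: (@dominated_cvg _ _ _ _ _ measurableT
  (fun (m : nat) w => (ramp m%:R 0 (X' w t))%:E) (cst 0%E) (cst 1%E)).
- move=> m; apply/measurable_EFinP; apply: measurableT_comp; last exact: mX'.
  by apply: continuous_measurable_fun; exact: continuous_ramp.
- move=> w _; apply: cvg_near_cst; near=> m.
  congr EFin; apply: ramp_eq0; near: m; exact: nbhs_infty_ger.
- by [].
- exact: (finite_measure_integrable_cst P' 1).
- by move=> m w _ /=; rewrite lee_fin ger0_norm ?ramp_ge0// ramp_le1.
Unshelve. all: by end_near. Qed.

Lemma fdd_tight t e : fdd_cvg P X P' X' -> 0 <= t -> 0 < e ->
  exists2 K, 0 < K & \forall p \near \oo, (P p [set w | (K < X p w t)%R] <= e%:E)%E.
Proof.
move=> fdd t0 e0.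
have fin d0 (T0 : measurableType d0) (P0 : probability T0 R) (X0 : T0 -> R) m :
    measurable_fun setT X0 -> ('E_P0[fun w => ramp m 0 (X0 w)])%E \is a fin_num.
  move=> mX0; rewrite unlock; apply: integrable_fin_num => //.
  apply: (@le_integrable _ _ _ P0 setT measurableT _ (EFin \o cst 1)).
  - apply/measurable_EFinP; apply: measurableT_comp => //.
    by apply: continuous_measurable_fun; exact: continuous_ramp.
  - by move=> w _ /=; rewrite lee_fin !ger0_norm ?ramp_ge0// ramp_le1.
  - exact: finite_measure_integrable_cst.
have := mean_ramp_cvg0 t0 => /fine_cvg/cvgr_lt/(_ _ e0)[m _ /(_ m (leqnn m))/= me].
exists m.+1%:R => //.
pose f (h : {ptws 'I_1 -> R}) : R := ramp m%:R 0 (h ord0).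
have cf : continuous f.
  move=> h; apply: (@continuous_comp _ _ _ (fun h : {ptws 'I_1 -> R} => h ord0)
    (ramp m%:R 0)); last exact: continuous_ramp.
  exact: (@proj_continuous _ (fun _ : 'I_1 => R) ord0).
have bf : exists M, forall h, `|f h| <= M.
  by exists 1 => h; rewrite ger0_norm ?ramp_ge0// ramp_le1.
have := fdd 1%N (fun=> t) (fun=> t0) f cf bf.
rewrite -(fineK (fin _ _ P' (X'^~ t) m%:R (mX' t0))) => /fine_cvg/cvgr_lt/(_ _ me) H.
near=> p.
apply: (@le_trans _ _ (fine ('E_(P p)[fun w => ramp m%:R 0 (X p w t)])%E)%:E); last first.
  by rewrite lee_fin ltW//; near: p; exact: H.
rewrite fineK; last exact: (fin _ _ (P p) (fun w => X p w t) m%:R (@mX p t t0)).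
have mA : measurable [set w | m.+1%:R < X p w t].
  rewrite (_ : [set _ | _] = (fun w => X p w t) @^-1` `]m.+1%:R, +oo[).
    rewrite -[Z in measurable Z]setTI; exact: (@mX p t t0 measurableT _ (measurable_itv _)).
  by apply/seteqP; split => w /=; rewrite in_itv/= andbT.
rewrite unlock -[Z in (P p Z <= _)%E]setIT -integral_indic//.
apply: ge0_le_integral => //.
- by apply/measurable_EFinP; exact: measurable_indic.
- apply/measurable_EFinP; apply: measurableT_comp; last exact: mX.
  by apply: continuous_measurable_fun; exact: continuous_ramp.
- move=> w _; rewrite lee_fin indicE; have [mw|_] := boolP (w \in _); last exact: ramp_ge0.
  move: mw; rewrite inE /= => mw; rewrite /ramp mul1r (min_idPl _)// le_max.
  by rewrite lerBrDl natr1 (ltW mw) orbT.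
Unshelve. all: by end_near. Qed.
End Tightness.

(** The deviation allowed by [height_deviation] with [lam := dl / (8 * e)], once
    rescaled by [e], takes half of [dl] and the error on the mean takes a quarter. *)
Lemma rescaled_gap_le (R : realType) (c g a al e dl K n k eta : R) :
  0 < e -> 0 <= g -> 0 < dl -> 0 < K -> e * g <= K -> 0 <= n -> e * n <= K ->
  0 <= k <= dl / (8 * (K + 1)) -> eta = dl / (16 * (K + 1)) ->
  `|a - al| <= dl / (4 * (K + 1)) ->
  `|c - a * g| <= 2 * (dl / (8 * e)) + (2 * eta + k) * n ->
  `|e * c - al * (e * g)| <= dl.
Proof.
move=> e0 g0 dl0 K0 egK n0 enK /andP[k0 kle] etaE aal gap.
have K1 : K + 1 != 0 by rewrite gt_eqF// ltr_wpDr.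
pose q := dl / (K + 1).
have q0 : 0 <= q by rewrite divr_ge0 ?addr_ge0// ltW.
have qE : q * (K + 1) = dl by rewrite /q mulfVK.
have kq : k <= q / 8 by rewrite (le_trans kle)// /q le_eqVlt; apply/orP; left; apply/eqP; field.
have etaq : eta = q / 16 by rewrite etaE /q; field.
have aq : `|a - al| <= q / 4 by rewrite (le_trans aal)// /q le_eqVlt; apply/orP; left; apply/eqP; field.
have -> : e * c - al * (e * g) = e * (c - a * g) + (a - al) * (e * g) by ring.
rewrite (le_trans (ler_normD _ _))// !normrM (gtr0_norm e0) (ger0_norm g0).
have h1 : e * `|c - a * g| <= dl / 4 + (q / 4) * K.
  apply: (@le_trans _ _ (e * (2 * (dl / (8 * e)) + (2 * eta + k) * n))).
    by rewrite ler_wpM2l// ltW.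
  have -> : e * (2 * (dl / (8 * e)) + (2 * eta + k) * n) =
      dl / 4 + (2 * eta + k) * (e * n).
    by field; rewrite gt_eqF.
  rewrite lerD2l ler_pM//; [|by rewrite mulr_ge0// ltW|by rewrite etaq; lra].
  by rewrite etaq; lra.
have h2 : `|a - al| * (e * g) <= (q / 4) * K by rewrite ler_pM// mulr_ge0// ltW.
lra.
Qed.

(** For [n] and [lam] of order [1 / e] the second moment term is of order [e] and
    the first moment term of order [k]. *)
Lemma deviation_bound_le (R : realType) (n a al M k e dl K x : R) :
  0 < e -> 0 < dl -> 0 < K -> 0 <= n -> e * n <= K -> 0 < x -> 0 <= M ->
  0 <= a <= al + 1 ->
  e <= x * dl ^+ 2 / (64 * (K + 1) * ((al + 1 + M) ^+ 2 + 1)) ->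
  0 <= k <= x * dl / (8 * (K + 1)) ->
  n * (a + M) ^+ 2 / (dl / (8 * e)) ^+ 2 + n * k / (dl / (8 * e)) <= x + x.
Proof.
move=> e0 dl0 K0 n0 enK x0 M0 /andP[a0 aal] ele /andP[k0 kle].
have en0 : 0 <= e * n by rewrite mulr_ge0// ltW.
have K1 : 0 < K + 1 by rewrite ltr_wpDr.
have eN : e != 0 by rewrite gt_eqF.
have dN : dl != 0 by rewrite gt_eqF.
have aM : 0 <= (a + M) ^+ 2 <= (al + 1 + M) ^+ 2.
  have al0 := le_trans a0 aal.
  by rewrite sqr_ge0/= ler_sqr ?nnegrE ?lerD2r// ?(addr_ge0 al0 M0)// addr_ge0.
have {aM}[aM0 aM] := andP aM.
set B := (al + 1 + M) ^+ 2 in ele aM.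
have B0 : 0 <= B by exact: sqr_ge0.
apply: lerD.
  have -> : n * (a + M) ^+ 2 / (dl / (8 * e)) ^+ 2 =
     (e * n) * (64 * e * (a + M) ^+ 2) / dl ^+ 2 by field; rewrite eN dN.
  rewrite ler_pdivrMr ?exprn_gt0//.
  apply: (@le_trans _ _ ((K + 1) * (64 * e * (B + 1)))).
    apply: ler_pM => //; first by apply: mulr_ge0 => //; apply: mulr_ge0 => //; exact: ltW.
      by rewrite (le_trans enK)// lerDl.
    by apply: ler_pM => //; rewrite ?mulr_ge0 ?(ltW e0)// (le_trans aM)// lerDl.
  have := ele; rewrite ler_pdivlMr; first by apply: le_trans; rewrite le_eqVlt; apply/orP; left; apply/eqP; ring.
  by rewrite !mulr_gt0// ltr_wpDl.
have -> : n * k / (dl / (8 * e)) = (e * n) * (8 * k) / dl by field; rewrite eN dN.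
rewrite ler_pdivrMr//.
apply: (@le_trans _ _ ((K + 1) * (8 * k))).
  by rewrite ler_wpM2r ?mulr_ge0// (le_trans enK)// lerDl.
have := kle; rewrite ler_pdivlMr ?mulr_gt0//.
by apply: le_trans; rewrite le_eqVlt; apply/orP; left; apply/eqP; ring.
Qed.

(** * Comparison of the rescaled heights *)

Lemma measurable_set_gt (R : realType) d (T : measurableType d) (F : T -> R) (c : R) :
  measurable_fun setT F -> measurable [set w | c < F w].
Proof.
move=> mF; rewrite (_ : [set _ | _] = F @^-1` `]c, +oo[).
  rewrite -[X in measurable X]setTI; exact: (mF measurableT _ (measurable_itv _)).
by apply/seteqP; split => w /=; rewrite in_itv/= andbT.
Qed.

Section HeightsRatio.
Context {R : realType}.
Context (d : nat -> measure_display) (T : forall p, measurableType (d p))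
  (Pr : forall p, probability (T p) R) (VP : forall p, {RV (Pr p) >-> L R}).
Context (PP : nat -> probability (Omega R) R) (eps : nat -> R).
Context (dY : nat -> measure_display) (TY : forall p, measurableType (dY p))
  (PrY : forall p, probability (TY p) R) (Y : forall p, {RV (PrY p) >-> R}).
Variables (alpha : R).
Let EY p : \bar R := ('E_(PrY p)[Y p])%E.
Hypothesis m01 : forall p, (1 <= p)%N ->
  (0 < mean_mass (Pr p) (fun w => children (VP p w)) <= 1)%E.
Hypothesis iid : forall p, (1 <= p)%N ->
    identically_distributed (PP p) (distribution (Pr p) (VP p)) /\
    independent_coordinates (PP p).
Hypothesis eps0 : forall p, (1 <= p)%N -> 0 < eps p.
Hypothesis eps_cvg : eps p @[p --> \oo] --> 0.
Hypothesis hY : forall p, (1 <= p)%N ->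
    has_Ystar_law (Pr p) (fun w => children (VP p w)) (PrY p) (Y p).
Hypothesis EY_fin : forall p, (1 <= p)%N -> (EY p < +oo)%E.
Hypothesis EY_cvg : EY p @[p --> \oo] --> alpha%:E.
Hypothesis tail : forall e, 0 < e -> exists2 M, 0 <= M &
  \forall p \near \oo, \int[PrY p]_w Num.max (Y p w - fine (EY p) - M) 0 <= e.
Variable n : nat -> nat.
Hypothesis tight : forall e, 0 < e -> exists2 K, 0 < K &
  \forall p \near \oo,
    (PP p [set w | (K < eps p * genealogical_height w (n p))%R] <= e%:E)%E.

Lemma heights_ratio_cvg (dl e : R) : 0 < dl -> 0 < e ->
  \forall p \near \oo, (PP p [set w | (dl < `|eps p * chronological_height w (n p) -
     alpha * (eps p * genealogical_height w (n p))|)%R] <= e%:E)%E.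
Proof.
move=> dl0 e0; have e30 : 0 < e / 3 by lra.
have [K K0 tightK] := tight e30.
have K10 : 0 < K + 1 by lra.
(* [k] and [c] are the bounds on the mean excess and on [eps p] that
   [rescaled_gap_le] and [deviation_bound_le] ask for *)
pose k := Num.min (dl / (8 * (K + 1))) ((e / 3) * dl / (8 * (K + 1))).
have k0 : 0 < k by rewrite lt_min !divr_gt0 ?mulr_gt0.
have [M M0 tailM] := tail k0.
pose c := (e / 3) * dl ^+ 2 / (64 * (K + 1) * ((alpha + 1 + M) ^+ 2 + 1)).
have c0 : 0 < c.
  by rewrite /c divr_gt0 ?mulr_gt0 ?exprn_gt0// ltr_wpDl ?sqr_ge0.
have acvg : fine (EY p) @[p --> \oo] --> alpha by exact: fine_cvg EY_cvg.
have nc := cvgr_le _ eps_cvg _ c0.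
have na : \forall p \near \oo, fine (EY p) <= alpha + 1.
  by apply: (cvgr_le _ acvg); lra.
have nd : \forall p \near \oo, `|fine (EY p) - alpha| <= dl / (4 * (K + 1)).
  by apply: (cvgr_distC_le _ _ acvg); rewrite divr_gt0// mulr_gt0.
near=> p.
have p1 : (1 <= p)%N by near: p; exact: nbhs_infty_ge.
have ep0 := eps0 p1.
have [pid pind] := iid p1.
have epc : eps p <= c by near: p; exact: nc.
have a1 : fine (EY p) <= alpha + 1 by near: p.
have adl : `|fine (EY p) - alpha| <= dl / (4 * (K + 1)) by near: p.
have kappak : \int[PrY p]_w Num.max (Y p w - fine (EY p) - M) 0 <= k by near: p.
have tK : (PP p [set w | (K < eps p * genealogical_height w (n p))%R] <= (e / 3)%:E)%E.
  by near: p.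
set a := fine (EY p) in a1 adl.
set kappa := \int[PrY p]_w Num.max (Y p w - fine (EY p) - M) 0 in kappak.
(* a third of [e] is left to the event of more than [N] marks, the rest to the
   deviations within [N] marks *)
pose N := Num.truncn (K / eps p).
pose lam := dl / (8 * eps p); pose eta := dl / (16 * (K + 1)).
have lam0 : 0 < lam by rewrite divr_gt0// mulr_gt0.
have eta0 : 0 < eta by rewrite divr_gt0// mulr_gt0.
have Ke0 : 0 <= K / eps p by rewrite divr_ge0// ltW.
have eN : eps p * N%:R <= K.
  by rewrite mulrC -ler_pdivlMr//; have /andP[] := truncn_itv Ke0.
have kappa0 : 0 <= kappa.
  by apply: Rintegral_ge0 => // w _; rewrite le_max lexx orbT.
have /andP[kappa1 kappa2] : (kappa <= dl / (8 * (K + 1))) && (kappa <= (e / 3) * dl / (8 * (K + 1))).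
  by rewrite -le_min.
have dev := height_deviation pid pind (m01 p1) (hY p1) (EY_fin p1) N (n p) eta0 lam0 M0.
set A := [set w | _] in tK.
set D := [set w | _] in dev.
have mA : measurable A.
  apply: measurable_set_gt; apply: measurable_funM => //.
  exact: measurable_genealogical_height.
have mD : measurable D.
  rewrite (_ : D = ~` [set w | N%:R < genealogical_height w (n p)] `&`
     [set w | 2 * lam + (2 * eta + kappa) * N%:R <
       `|chronological_height w (n p) - a * genealogical_height w (n p)|]).
    apply: measurableI.
      apply: measurableC; apply: measurable_set_gt.
      exact: measurable_genealogical_height.
    apply: measurable_set_gt; apply: measurableT_comp => //; apply: measurable_funB.
      exact: measurable_chronological_height.
    by apply: measurable_funM => //; exact: measurable_genealogical_height.
  apply/seteqP; split => w [gN ?]; split => //=.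
    by apply/negP; rewrite -leNgt.
  by rewrite leNgt; apply/negP.
apply: (@le_trans _ _ (PP p (A `|` D))).
  apply: le_measure; rewrite ?inE.
  - apply: measurable_set_gt; apply: measurableT_comp => //; apply: measurable_funB.
      by apply: measurable_funM => //; exact: measurable_chronological_height.
    apply: measurable_funM => //; apply: measurable_funM => //.
    exact: measurable_genealogical_height.
  - exact: measurableU.
  move=> w /= gap; have [gK|Kg] := leP (eps p * genealogical_height w (n p)) K; last by left.
  right; split.
    move: gK; rewrite (genealogical_height_code 1) ler_nat truncn_ge_nat//.
    by rewrite mulrC -ler_pdivlMr.
  rewrite ltNge; apply/negP => small; move: gap; rewrite ltNge => /negP; apply.
  apply: (@rescaled_gap_le _ _ _ a alpha (eps p) dl K N%:R kappa eta) => //.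
  - exact: genealogical_height_ge0.
  - by rewrite kappa0.
apply: (le_trans (measureU2 _ mA mD)).
have -> : e%:E = ((e / 3)%:E + (e / 3 + e / 3)%:E)%E by rewrite -EFinD; congr EFin; field.
apply: leeD => //; apply: (le_trans dev); rewrite lee_fin.
apply: (@deviation_bound_le _ _ _ alpha M kappa (eps p) dl K) => //.
- by rewrite a1 (Ystar_mean_ge0 (Ystar_ge0 (hY p1))).
- by rewrite kappa0.
Unshelve. all: by end_near. Qed.

End HeightsRatio.

(** * Perturbing one component in convergence of finite-dimensional laws *)

Lemma ptws_cvg (I : eqType) (E : topologicalType) (F : set_system (I -> E)) (y : I -> E) :
  Filter F -> (forall i, (fun g => g i) @ F --> y i) ->
  F --> (y : {ptws I -> E}).
Proof.
move=> FF H; apply/cvg_sup => i A [B [[C oC <-] Cy] CA].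
apply: filterS CA _; apply: (H i); exact: open_nbhs_nbhs.
Qed.

Lemma continuous_ptws (S : topologicalType) (I : eqType) (E : topologicalType)
    (phi : S -> {ptws I -> E}) :
  (forall i, continuous (fun s => phi s i : E)) -> continuous phi.
Proof.
move=> H s; apply/cvg_sup => i A [B [[C oC <-] Cy] CA].
apply: filterS CA _; apply: (H i s); exact: open_nbhs_nbhs.
Qed.

Section Perturbation.
Context {R : realType} (n : nat).

Lemma near_ptws (E : topologicalType) (y : 'I_n -> E) (A : 'I_n -> set E) :
  (forall i, nbhs (y i) (A i)) ->
  \forall y' \near (y : {ptws 'I_n -> E}), forall i, A i (y' i).
Proof.
move=> H; apply: (@filter_forall {ptws 'I_n -> E} 'I_n (fun i y' => A i (y' i)) _
    (nbhs_filter (y : {ptws 'I_n -> E}))) => i.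
exact: (@proj_continuous _ (fun _ : 'I_n => E) i y _ (H i)).
Qed.

(** As there are finitely many indices, the uniform balls form a basis of
    neighbourhoods for pointwise convergence. *)
Lemma ptws_ball (y1 y2 : 'I_n -> R) (U : set {ptws 'I_n -> (R * R)%type}) :
  nbhs ((fun i => (y1 i, y2 i)) : {ptws 'I_n -> (R * R)%type}) U ->
  exists2 r, 0 < r & forall z1 z2 : 'I_n -> R,
    (forall i, `|z1 i - y1 i| < r /\ `|z2 i - y2 i| < r) -> U (fun i => (z1 i, z2 i)).
Proof.
move=> nU.
pose F : set_system ('I_n -> (R * R)%type) := filter_from [set r : R | 0 < r] (fun r =>
  [set z | forall i, `|(z i).1 - y1 i| < r /\ `|(z i).2 - y2 i| < r]).
have FF : Filter F.
  apply: filter_from_filter; first by exists 1 => /=.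
  move=> r s /= r0 s0; exists (Num.min r s); first by rewrite /= lt_min r0.
  by move=> z H; split => i; have [] := H i; rewrite !lt_min => /andP[? ?] /andP[? ?].
have cF : F --> ((fun i => (y1 i, y2 i)) : {ptws 'I_n -> (R * R)%type}).
  apply: ptws_cvg => i; apply/cvg_ballP => e e0; exists e => // z /(_ i) [h1 h2].
  by split; rewrite /= -ball_normE /= distrC.
have [r /= r0 rU] := cF _ nU.
by exists r => // z1 z2 H; apply: rU.
Qed.

(** Uniformity over the compact set of the [h] with values in [`[0, K]]; only the
    perturbation of [alpha * h], not [g] itself, has to be controlled. *)
Lemma perturbation_modulus (f : {ptws 'I_n -> (R * R)%type} -> R) (alpha K e : R) :
  continuous f -> 0 < e ->
  exists2 dl, 0 < dl & forall h g : 'I_n -> R, (forall i, 0 <= h i <= K) ->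
    (forall i, `|g i - alpha * h i| <= dl) ->
    `|f (fun i => (h i, g i)) - f (fun i => (h i, alpha * h i))| <= e.
Proof.
move=> cf e0; pose C : set {ptws 'I_n -> R} := [set h | forall i, `[0, K]%classic (h i)].
have cC : compact C.
  by apply: (@tychonoff 'I_n (fun _ => R) (fun _ => `[0, K]%classic)) => i; exact: segment_compact.
pose Q (dl : R) (h : {ptws 'I_n -> R}) := forall g : 'I_n -> R,
  (forall i, `|g i - alpha * h i| <= dl) ->
  `|f (fun i => (h i, g i)) - f (fun i => (h i, alpha * h i))| <= e.
have : \forall dl \near 0^'+, C `<=` Q dl.
  apply: ((compact_near_coveringP C).1 cC) => h Ch.
  pose y : {ptws 'I_n -> (R * R)%type} := fun i => (h i, alpha * h i).
  have : \forall y' \near y, `|f y - f y'| < e / 2.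
    by have /cvgrPdist_lt := cf y; apply; rewrite divr_gt0.
  move=> /ptws_ball[r r0 rU].
  have a0 : 0 < `|alpha| + 1 by rewrite ltr_wpDl.
  pose s := r / (2 * (`|alpha| + 1)).
  have s0 : 0 < s by rewrite divr_gt0// mulr_gt0.
  exists ([set h' | forall i, `|h' i - h i| < s], [set dl | dl < r / 2]).
    split => /=; last by apply: nbhs_right_lt; rewrite divr_gt0.
    apply: (@near_ptws R h (fun i x => `|x - h i| < s)) => i.
    by exists s => // z /=; rewrite distrC.
  move=> [h' dl] /= [hs dlr] g gdl.
  have sE : s * (2 * (`|alpha| + 1)) = r by rewrite /s mulfVK// gt_eqF// mulr_gt0.
  have as_ : `|alpha| * s <= r / 2 by nra.
  have sr : s <= r by have := normr_ge0 alpha; nra.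
  have ah i : `|alpha * h' i - alpha * h i| <= r / 2.
    rewrite -mulrBr normrM (le_trans _ as_)// ler_wpM2l//; exact/ltW/hs.
  have u1 : `|f y - f (fun i => (h' i, g i))| < e / 2.
    apply: rU => i; split; first exact: lt_le_trans (hs i) sr.
    rewrite -(subrKA (alpha * h' i)) (le_lt_trans (ler_normD _ _))//.
    by have := gdl i; have := ah i; lra.
  have u2 : `|f y - f (fun i => (h' i, alpha * h' i))| < e / 2.
    apply: rU => i; split; first exact: lt_le_trans (hs i) sr.
    by have := ah i; lra.
  rewrite -(subrKA (f y)) (le_trans (ler_normD _ _))// [e]splitr lerD//.
    by rewrite distrC ltW.
  exact: ltW.
move=> nQ; have [dl [dl0 H]] := filter_ex (filterI (nbhs_right_gt (0 : R)) nQ).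
exists dl => // h g h0K; apply: (H h) => i /=.
by rewrite in_itv /=; exact: h0K.
Qed.

(** Rounded coordinates take countably many values, which makes any function of
    them measurable; [f] being continuous, these functions converge pointwise. *)
Lemma measurable_cont_tuple d (T : measurableType d) (f : {ptws 'I_n -> (R * R)%type} -> R)
    (X1 X2 : 'I_n -> T -> R) :
  continuous f ->
  (forall i, measurable_fun setT (X1 i)) -> (forall i, measurable_fun setT (X2 i)) ->
  (forall i w, 0 <= X1 i w) -> (forall i w, 0 <= X2 i w) ->
  measurable_fun setT (fun w => f (fun i => (X1 i w, X2 i w))).
Proof.
move=> cf mX1 mX2 X10 X20; pose eta m : R := m.+1%:R^-1.
have eta0 m : 0 < eta m by rewrite invr_gt0.
pose Z m w : {ffun 'I_n -> nat * nat} := [ffun i => (cell (eta m) (X1 i w), cell (eta m) (X2 i w))].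
have mZ m c : measurable [set w | Z m w = c].
  rewrite (_ : [set _ | _] = \bigcap_i
     ((cell (eta m) \o X1 i) @^-1` [set (c i).1] `&` (cell (eta m) \o X2 i) @^-1` [set (c i).2])).
    apply: fin_bigcap_measurable => // i _; apply: measurableI.
      rewrite -[X in measurable X]setTI.
      by apply: (measurableT_comp (measurable_cell_fun (eta0 m)) (mX1 i)).
    rewrite -[X in measurable X]setTI.
    by apply: (measurableT_comp (measurable_cell_fun (eta0 m)) (mX2 i)).
  apply/seteqP; split => w /=.
    by move=> <- i _; rewrite /= ffunE.
  move=> H; apply/ffunP => i; rewrite ffunE.
  by have [/= -> ->] := H i I; case: (c i).
apply: (@measurable_realfun.measurable_fun_cvg _ _ _ _ (fun m w =>
  f (fun i => ((Z m w i).1%:R * eta m, (Z m w i).2%:R * eta m)))) => [m|w _].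
  exact: (measurable_fun_countable (mZ m)
    (fun c : {ffun 'I_n -> nat * nat} => f (fun i => ((c i).1%:R * eta m, (c i).2%:R * eta m)))).
apply: (cvg_comp (fun m => (fun i => ((Z m w i).1%:R * eta m, (Z m w i).2%:R * eta m))
  : {ptws 'I_n -> (R * R)%type}) f); last exact: cf.
apply: ptws_cvg => i.
have cvg_cell (x : R) : 0 <= x -> (cell (eta m) x)%:R * eta m @[m --> \oo] --> x.
  move=> x0; apply: (@squeeze_cvgr _ _ _ _ (fun m => x - eta m) (fun=> x)).
  - apply: nearW => m; have /andP[h1 h2] := cell_bounds (eta0 m) x0.
    by rewrite subr_ge0 in h1; rewrite h1 andbT lerBlDr -lerBlDl.
  - by rewrite -[X in _ --> X]subr0; apply: cvgB; [exact: cvg_cst|exact: cvg_harmonic].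
  - exact: cvg_cst.
have E : (fun m => ((Z m w i).1%:R * eta m, (Z m w i).2%:R * eta m)) =
    (fun m => ((cell (eta m) (X1 i w))%:R * eta m, (cell (eta m) (X2 i w))%:R * eta m)).
  by apply/funext => m; rewrite ffunE.
rewrite [X in X --> _](_ : _ = (fun m => ((Z m w i).1%:R * eta m, (Z m w i).2%:R * eta m)) @ \oo)//.
rewrite E.
exact: cvg_pair (cvg_cell _ (X10 i w)) (cvg_cell _ (X20 i w)).
Qed.

End Perturbation.

Section Slutsky.
Context {R : realType} (d : nat -> measure_display)
  (T : forall p, measurableType (d p)) (P : forall p, probability (T p) R)
  (X Z : forall p, T p -> R -> R)
  (d' : measure_display) (T' : measurableType d') (P' : probability T' R)
  (X' : T' -> R -> R) (alpha : R).
Arguments X : clear implicits.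
Arguments Z : clear implicits.
Hypotheses (mX : forall p (t : R), measurable_fun setT (fun w => X p w t))
  (mZ : forall p (t : R), measurable_fun setT (fun w => Z p w t))
  (X0 : forall p w (t : R), (1 <= p)%N -> 0 <= X p w t)
  (Z0 : forall p w (t : R), (1 <= p)%N -> 0 <= Z p w t)
  (alpha0 : 0 <= alpha).

Lemma probability_exists_le d0 (T0 : measurableType d0) (P0 : probability T0 R)
    (I : eqType) (s : seq I) (A : I -> set T0) (e : R) :
  (forall i, measurable (A i)) -> (forall i, (P0 (A i) <= e%:E)%E) ->
  (P0 [set w | exists2 i, i \in s & A i w] <= ((size s)%:R * e)%:E)%E /\
  measurable [set w | exists2 i, i \in s & A i w].
Proof.
move=> mA PA; elim: s => [|i s [IH mI]].
  rewrite (_ : [set _ | _] = set0) ?measure0 ?mul0r//.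
  by apply/seteqP; split => w // [].
have -> : [set w | exists2 j, j \in i :: s & A j w] = A i `|` [set w | exists2 j, j \in s & A j w].
  apply/seteqP; split => w /=.
    by move=> [j]; rewrite inE => /predU1P[->|js] Aw; [left|right; exists j].
  case=> [Aw|[j js Aw]]; first by exists i; rewrite ?mem_head.
  by exists j => //; rewrite inE js orbT.
split; last exact: measurableU.
apply: le_trans (measureU2 _ (mA i) mI) _.
by rewrite -[(size (i :: s))%:R]nat1r mulrDl mul1r EFinD; exact: leeD (PA i) IH.
Qed.

Lemma bounded_integrable d0 (T0 : measurableType d0) (P0 : probability T0 R)
    (F : T0 -> R) (B : R) :
  measurable_fun setT F -> (forall w, `|F w| <= B) -> P0.-integrable setT (EFin \o F).
Proof.
move=> mF FB; apply: (@le_integrable _ _ _ P0 setT measurableT _ (EFin \o cst B)).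
- exact/measurable_EFinP.
- by move=> w _ /=; rewrite lee_fin (le_trans (FB w))// ler_norm.
- exact: finite_measure_integrable_cst.
Qed.

Lemma mean_dist_le d0 (T0 : measurableType d0) (P0 : probability T0 R)
    (F G : T0 -> R) (B e x : R) (D : set T0) :
  measurable_fun setT F -> measurable_fun setT G -> measurable D ->
  (forall w, `|F w| <= B) -> (forall w, `|G w| <= B) -> 0 <= e ->
  (forall w, ~ D w -> `|F w - G w| <= e) -> (P0 D <= x%:E)%E ->
  `|\int[P0]_w F w - \int[P0]_w G w| <= e + 2 * B * x.
Proof.
move=> mF mG mD FB GB e0 FG Dx.
have iF := bounded_integrable P0 mF FB; have iG := bounded_integrable P0 mG GB.
have iFG := integrableB measurableT iF iG.
have [w0 _] : [set: T0] !=set0.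
  apply/set0P/eqP => T00; have := probability_setT P0.
  by rewrite T00 measure0 => /eqP; rewrite eq_sym onee_eq0.
have B0 : 0 <= B := le_trans (normr_ge0 _) (FB w0).
rewrite -RintegralB//; apply: (le_trans (le_normr_Rintegral _ iFG)) => //.
have iD : P0.-integrable setT (EFin \o (fun w => 2 * B * \1_D w)).
  apply: (@bounded_integrable _ _ _ _ (2 * B)).
    by apply: measurable_funM => //; exact: measurable_indic.
  move=> w; rewrite indicE normrM ger0_norm ?mulr_ge0// ger0_norm//.
  by rewrite ler_piMr ?mulr_ge0// lern1 leq_b1.
have ie : P0.-integrable setT (EFin \o (cst e)) := finite_measure_integrable_cst P0 e measurableT.
apply: (@le_trans _ _ (\int[P0]_w (e + 2 * B * \1_D w))).
  apply: le_Rintegral => //.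
  - have := integrable_norm iFG; congr (_.-integrable _ _).
  - exact: (integrableD measurableT ie iD).
  - move=> w _; rewrite indicE; have [Dw|nDw] := boolP (w \in D).
      rewrite mulr1 ler_wpDl// (le_trans (ler_normB _ _))//.
      by have := FB w; have := GB w; lra.
    by rewrite mulr0 addr0; apply: FG => Dw; move: nDw; rewrite mem_set.
rewrite RintegralD// RintegralZl//; last first.
  apply: (@bounded_integrable _ _ _ _ 1); first exact: measurable_indic.
  by move=> w; rewrite indicE ger0_norm// lern1 leq_b1.
have -> : \int[P0]_w cst e w = e.
  rewrite -[RHS]mulr1 -[X in _ = _ * X]/(fine (1%E : \bar R)) -(probability_setT P0).
  exact: Rintegral_cst.
rewrite lerD2l ler_wpM2l ?mulr_ge0// /Rintegral integral_indic// setIT.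
by rewrite -lee_fin fineK ?fin_num_measure.
Qed.

(** Slutsky's argument: outside an event of small probability the first
    components stay in a compact set and the second ones are close to [alpha]
    times the first ones, where [f] is uniformly continuous. *)
Lemma fdd_perturbation :
  fdd_cvg P X P' X' ->
  (forall (t e : R), 0 <= t -> 0 < e -> exists2 K, 0 < K &
    \forall p \near \oo, (P p [set w | (K < X p w t)%R] <= e%:E)%E) ->
  (forall (t dl e : R), 0 <= t -> 0 < dl -> 0 < e -> \forall p \near \oo,
    (P p [set w | (dl < `|Z p w t - alpha * X p w t|)%R] <= e%:E)%E) ->
  fdd_cvg P (fun p w t => (X p w t, Z p w t)) P' (fun s t => (X' s t, alpha * X' s t)).
Proof.
move=> fdd tight gap n t t0 f cf [B fB].
pose phi (h : {ptws 'I_n -> R}) : {ptws 'I_n -> (R * R)%type} := fun i => (h i, alpha * h i).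
have cphi : continuous phi.
  apply: continuous_ptws => i h.
  have ci : (fun h' : {ptws 'I_n -> R} => h' i) @ h --> h i.
    exact: (@proj_continuous _ (fun _ : 'I_n => R) i).
  have ci2 : (fun h' : {ptws 'I_n -> R} => alpha * h' i) @ h --> alpha * h i.
    apply: (cvg_comp (fun h' : {ptws 'I_n -> R} => h' i) ( *%R alpha) ci).
    exact: mulrl_continuous.
  exact: (cvg_pair ci ci2).
pose g : {ptws 'I_n -> R} -> R := f \o phi.
have cg : continuous g.
  by move=> h; apply: (@continuous_comp _ _ _ phi f); [exact: cphi|exact: cf].
have gB : exists M, forall h, `|g h| <= M by exists B => h; exact: fB.
pose F p (w : T p) := f (fun i => (X p w (t i), Z p w (t i))).
pose G p (w : T p) := f (fun i => (X p w (t i), alpha * X p w (t i))).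
have mF p : (1 <= p)%N -> measurable_fun setT (F p).
  by move=> p1; apply: (measurable_cont_tuple (X1 := fun i w => X p w (t i))
    (X2 := fun i w => Z p w (t i)) cf) => // i w; [exact: X0|exact: Z0].
have mG p : (1 <= p)%N -> measurable_fun setT (G p).
  move=> p1; apply: (measurable_cont_tuple (X1 := fun i w => X p w (t i))
    (X2 := fun i w => alpha * X p w (t i)) cf) => // i.
  - by apply: measurable_funM.
  - by move=> w; exact: X0.
  - by move=> w; rewrite mulr_ge0// X0.
have B0 : 0 <= B := le_trans (normr_ge0 _) (fB (fun=> 0)).
have cvgG := fdd n t t0 g cg gB.
have finG p : (1 <= p)%N -> ('E_(P p)[G p])%E \is a fin_num.
  move=> p1; rewrite unlock; apply: integrable_fin_num => //.
  exact: (bounded_integrable (P p) (mG p p1) (fun w => fB _)).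
have boundG p : (1 <= p)%N -> `|\int[P p]_w G p w| <= B.
  move=> p1; have iG : (P p).-integrable setT (EFin \o G p).
    exact: (bounded_integrable (P p) (mG p p1) (fun w => fB _)).
  apply: (le_trans (le_normr_Rintegral _ iG)) => //.
  rewrite -[leRHS]mulr1 -[X in _ <= _ * X]/(fine (1%E : \bar R)) -(probability_setT (P p)).
  rewrite -Rintegral_cst//; apply: le_Rintegral => //.
  - by have := integrable_norm iG.
  - exact: finite_measure_integrable_cst.
  - by move=> w _; exact: fB.
pose l := 'E_P'[g \o (fun w i => X' w (t i))]%E.
(* as a limit of means bounded by [B] *)
have finl : l \is a fin_num.
  have bl q : (1 <= q)%N -> ((- B)%:E <= 'E_(P q)[G q] <= B%:E)%E.
    move=> q1; rewrite -(fineK (finG q q1)) !lee_fin -ler_norml.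
    by have := boundG q q1; rewrite unlock.
  have nearB : \forall p \near \oo, ((- B)%:E <= 'E_(P p)[G p] <= B%:E)%E.
    by exists 1%N => // q; exact: bl.
  have lB : (l <= B%:E)%E.
    by apply: (cvge_le _ cvgG); apply: filterS nearB => p /andP[].
  have Bl : ((- B)%:E <= l)%E.
    by apply: (cvge_ge _ cvgG); apply: filterS nearB => p /andP[].
  by rewrite fin_numElt (lt_le_trans (ltNyr _) Bl) (le_lt_trans lB (ltry _)).
move: cvgG; rewrite -/l -(fineK finl) => /fine_cvg cvgG.
apply/fine_cvgP; split.
  exists 1%N => // p p1; rewrite unlock; apply: integrable_fin_num => //.
  exact: (bounded_integrable (P p) (mF p p1) (fun w => fB _)).
apply/cvgrPdist_le => e e0.
(* [4 * B * n * x <= e / 4]: [x] bounds each of the [2 * n] exceptional events *)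
pose x := e / (16 * (B + 1) * n.+1%:R).
have x0 : 0 < x by rewrite divr_gt0// !mulr_gt0// ltr_wpDl.
have e4 : 0 < e / 4 by lra.
have [Kf HK] : {Kf : 'I_n -> R & forall i, 0 < Kf i /\
    \forall p \near \oo, (P p [set w | (Kf i < X p w (t i))%R] <= x%:E)%E}.
  apply: (@choice _ _ (fun i K => 0 < K /\ \forall p \near \oo,
    (P p [set w | (K < X p w (t i))%R] <= x%:E)%E)) => i; have [K K0 HK] := tight (t i) x (t0 i) x0.
  by exists K; split.
pose K := \sum_i Kf i.
have KfK i : Kf i <= K.
  rewrite /K (bigD1 i)//= lerDl; apply: sumr_ge0 => j _; exact/ltW/(HK j).1.
have [dl dl0 Hdl] := perturbation_modulus alpha K cf e4.
have nA : \forall p \near \oo, forall i, (P p [set w | (Kf i < X p w (t i))%R] <= x%:E)%E.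
  by apply: (@filter_forall _ 'I_n (fun i p => _)) => i; exact: (HK i).2.
have nD : \forall p \near \oo, forall i,
    (P p [set w | (dl < `|Z p w (t i) - alpha * X p w (t i)|)%R] <= x%:E)%E.
  by apply: (@filter_forall _ 'I_n (fun i p => _)) => i; exact: gap.
have nG : \forall p \near \oo, `|fine l - fine ('E_(P p)[G p])%E| <= e / 2.
  by move/cvgrPdist_le : cvgG; apply; lra.
near=> p.
have p1 : (1 <= p)%N by near: p; exact: nbhs_infty_ge.
have Ap : forall i, (P p [set w | (Kf i < X p w (t i))%R] <= x%:E)%E by near: p.
have Dp : forall i, (P p [set w | (dl < `|Z p w (t i) - alpha * X p w (t i)|)%R] <= x%:E)%E.
  by near: p.
have Gp : `|fine l - fine ('E_(P p)[G p])%E| <= e / 2 by near: p.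
pose A i := [set w | Kf i < X p w (t i)] `|`
  [set w | dl < `|Z p w (t i) - alpha * X p w (t i)|].
have mA1 i : measurable [set w | Kf i < X p w (t i)] by apply: measurable_set_gt.
have mA2 i : measurable [set w | dl < `|Z p w (t i) - alpha * X p w (t i)|].
  apply: measurable_set_gt; apply: measurableT_comp => //; apply: measurable_funB => //.
  exact: measurable_funM.
have mA i : measurable (A i) by exact: measurableU.
have PA i : (P p (A i) <= (x + x)%:E)%E.
  by apply: le_trans (measureU2 _ (mA1 i) (mA2 i)) _; rewrite EFinD; exact: leeD (Ap i) (Dp i).
have [PB mB] := probability_exists_le (enum 'I_n) mA PA.
rewrite size_enum_ord in PB.
have FG : `|\int[P p]_w F p w - \int[P p]_w G p w| <= e / 4 + 2 * B * (n%:R * (x + x)).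
  apply: (mean_dist_le (mF p p1) (mG p p1) mB (fun w => fB _) (fun w => fB _)
    (ltW e4) _ PB) => w nB; apply: Hdl => i.
    rewrite X0//= (le_trans _ (KfK i))// leNgt; apply/negP => h.
    by apply: nB; exists i; rewrite ?mem_enum//; left.
  rewrite leNgt; apply/negP => h.
  by apply: nB; exists i; rewrite ?mem_enum//; right.
have xE : 2 * B * (n%:R * (x + x)) <= e / 4.
  have -> : 2 * B * (n%:R * (x + x)) = (B * n%:R) * (4 * x) by ring.
  apply: (@le_trans _ _ (((B + 1) * n.+1%:R) * (4 * x))).
    apply: ler_wpM2r; first by rewrite mulr_ge0// ltW.
    by apply: ler_pM => //; rewrite ?lerDl ?ler_nat.
  rewrite /x le_eqVlt; apply/orP; left; apply/eqP; field.
  by rewrite !gt_eqF// ?ltr0n// ltr_wpDl.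
have Gl : `|fine l - \int[P p]_w G p w| <= e / 2 by move: Gp; rewrite unlock.
have Fl : `|fine l - \int[P p]_w F p w| <= e.
  rewrite -(subrKA (\int[P p]_w G p w)) (le_trans (ler_normD _ _))//.
  by rewrite distrC in FG; move: Gl FG xE; lra.
by move: Fl; rewrite /= unlock.
Unshelve. all: by end_near. Qed.

End Slutsky.

Theorem corollary4p3 (R : realType)
  (* the random variables (V^*_p, P^*_p) *)
  (d : nat -> measure_display) (T : forall p, measurableType (d p))
  (Pr : forall p, probability (T p) R)
  (VP : forall p, {RV (Pr p) >-> L R})
  (* the probabilities P_p on Omega *)
  (PP : nat -> probability (Omega R) R)
  (eps : nat -> R)
  (* the random variables Y^*_p *)
  (dY : nat -> measure_display) (TY : forall p, measurableType (dY p))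
  (PrY : forall p, probability (TY p) R)
  (Y : forall p, {RV (PrY p) >-> R})
  (* the limit of Y^*_p - E(Y^*_p) *)
  (db : measure_display) (Tb : measurableType db)
  (Prb : probability Tb R) (Ybar : {RV Prb >-> R})
  (alpha : R)
  (* the limit process H_infty *)
  (dH : measure_display) (TH : measurableType dH)
  (PrH : probability TH R) (Hinf : TH -> cadlag_path R)
  (mHinf : forall t : R, 0 <= t -> measurable_fun setT (fun s => Hinf s t)) :
  let m p : \bar R := mean_mass (Pr p) (fun w => children (VP p w)) in
  let EY p : \bar R := ('E_(PrY p)[Y p])%E in
  let Hp p (w : Omega R) := rescaled_path (eps p) p (genealogical_height w) in
  let HHp p (w : Omega R) := rescaled_path (eps p) p (chronological_height w) in
  (forall p, (1 <= p)%N -> (0 < m p <= 1)%E) ->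
  m p @[p --> \oo] --> 1%E ->
  (forall p, (1 <= p)%N ->
    identically_distributed (PP p) (distribution (Pr p) (VP p)) /\
    independent_coordinates (PP p)) ->
  (forall p, (1 <= p)%N -> 0 < eps p) ->
  eps p @[p --> \oo] --> 0 ->
  (forall p, (1 <= p)%N ->
    has_Ystar_law (Pr p) (fun w => children (VP p w)) (PrY p) (Y p)) ->
  (forall p, (1 <= p)%N -> (EY p < +oo)%E) ->
  Prb.-integrable setT (EFin \o Ybar) ->
  ('E_Prb[Ybar] = 0)%E ->
  cvg_in_law PrY (fun p w => (Y p w - fine (EY p))%R : R) Prb
    (Ybar : Tb -> R) ->
  ('E_(PrY p)[(fun w => Num.max (Y p w - fine (EY p)) 0)%R] @[p --> \oo] -->
    'E_Prb[(fun w => Num.max (Ybar w) 0)%R])%E ->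
  p%:R * eps p @[p --> \oo] --> +oo ->
  0 < alpha ->
  EY p @[p --> \oo] --> alpha%:E ->
  cvg_in_law PP Hp PrH Hinf ->
  fdd_cvg PP (fun p w t => Hp p w t) PrH (fun s t => Hinf s t) ->
  (forall t : R, 0 < t -> PrH [set s | 0 < Hinf s t] = 1%E) ->
  fdd_cvg PP (fun p w t => (Hp p w t, HHp p w t))
          PrH (fun s t => (Hinf s t, alpha * Hinf s t)).
Proof.
move=> m EY Hp HHp m01 _ iid eps0 eps_cvg hY EY_fin iYbar _ Ylaw Ypos _ alpha0
  EY_cvg _ fddH _.
have mH p (t : R) : measurable_fun setT (fun w => Hp p w t).
  by apply: measurable_funM => //; exact: measurable_genealogical_height.
have mHH p (t : R) : measurable_fun setT (fun w => HHp p w t).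
  by apply: measurable_funM => //; exact: measurable_chronological_height.
have tight (t e : R) : 0 <= t -> 0 < e -> exists2 K, 0 < K &
    \forall p \near \oo, (PP p [set w | (K < Hp p w t)%R] <= e%:E)%E.
  by move=> t0 e0; apply: (fdd_tight _ mHinf fddH).
have tail (e : R) : 0 < e -> exists2 M, 0 <= M &
    \forall p \near \oo, \int[PrY p]_w Num.max (Y p w - fine (EY p) - M) 0 <= e.
  move=> e0.
  apply: (near_tail_le (X := fun p w => Y p w - fine (EY p)) _ iYbar Ylaw Ypos e0) => p.
  exact: measurable_funB.
apply: (fdd_perturbation (X := fun p w t => Hp p w t) (Z := fun p w t => HHp p w t)) => //.
- by move=> p w t p1; rewrite mulr_ge0 ?genealogical_height_ge0// ltW// eps0.
- by move=> p w t p1; rewrite mulr_ge0 ?chronological_height_ge0// ltW// eps0.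
- exact: ltW.
move=> t dl e t0 dl0 e0.
apply: (heights_ratio_cvg m01 iid eps0 eps_cvg hY EY_fin EY_cvg tail
  (n := fun p => Num.truncn (p%:R * t))) => // x x0.
exact: tight.
Qed.
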